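(* Let $G$ be a compact Lie group with real Lie algebra $\mathfrak{g}_0$ and complexified Lie algebra $\mathfrak{g}$, and let $A$ be a finite $(\ast)$-subgroup of $G$. Let $n$ be the order of $\pi(A)$, where $\pi:G\to\mathrm{Aut}(\mathfrak{g}_0)$ is the adjoint homomorphism, and let $\mathfrak{g}'=\bigoplus_{p\mid n,\ p\text{ prime}}\mathfrak{g}_{(p)}$, where $\mathfrak{g}_{(p)}$ is the sum of the root spaces of $p$-power order roots. Then $\mathfrak{g}'$ is a reductive subalgebra of $\mathfrak{g}$, it is stable under the conjugation action of $A$, and $\mathfrak{g}'\cap\mathfrak{g}_0$ is a compact real form of it.
   Context: A $(\ast)$-subgroup of $G$ is a closed abelian subgroup $A$ with $\dim Z_G(A)=\dim A$ (so here $Z_{\mathfrak g}(A)=0$). $X^*(A)=\mathrm{Hom}(A,\mathrm{U}(1))$, written additively. For $\lambda\in X^*(A)$, $\mathfrak{g}_\lambda=\{Y\in\mathfrak{g}:\mathrm{Ad}(a)Y=\lambda(a)Y\ \forall a\in A\}$; $R=R(G,A)=\{\alpha\in X^*(A)-\{0\}:\mathfrak{g}_\alpha\neq0\}$. For a prime $p\mid n$, let $k\geq1$ be the largest integer with $p^k\mid n$; $R_{(p)}=\{\alpha\in R: p^k\alpha=0\text{ in }X^*(A)\}$ and $\mathfrak{g}_{(p)}=\bigoplus_{\alpha\in R_{(p)}}\mathfrak{g}_\alpha$. *)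

(* Defs.v *)
From HB Require Import structures.
From mathcomp Require Import all_boot all_order all_algebra.
From mathcomp Require Import complex.
From mathcomp Require Import all_classical all_reals all_analysis.

Set Implicit Arguments.
Unset Strict Implicit.
Unset Printing Implicit Defensive.

Import Order.TTheory GRing.Theory Num.Theory.
Import numFieldNormedType.Exports.

Local Open Scope classical_set_scope.
Local Open Scope ring_scope.

(* A group and a topology on the same carrier; the compatibility of the two is
   part of [lie_group] below. *)
#[short(type="groupTopologicalType")]
HB.structure Definition GroupTopological := {G of Group G & Topological G}.

Section Smooth.
Variable R : realType.

(* [U] is meant to be open; values of [f] outside [U] are irrelevant. *)
Fixpoint Ck (k : nat) (V W : normedModType R) (U : set V) (f : V -> W) : Prop :=
  match k with
  | 0 => forall x, U x -> {for x, continuous f}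
  | k'.+1 => (forall x, U x -> differentiable f x) /\
             forall v, Ck k' U (fun x => 'd f x v)
  end.

Definition smooth_on (V W : normedModType R) (U : set V) (f : V -> W) :=
  forall k, Ck k U f.

End Smooth.

Section LieGroup.
Variables (R : realType) (d : nat) (G : groupTopologicalType).
Local Notation E := 'rV[R]_d.

(* A homeomorphism from the open set [chart_dom] onto an open subset of R^d.
   [chart_fun] and [chart_inv] are total functions with irrelevant values
   outside [chart_dom] and its image. *)
Record chart := Chart {
  chart_dom : set G;
  chart_fun : G -> E;
  chart_inv : E -> G;
  chart_dom_open : open chart_dom;
  chart_img_open : open (chart_fun @` chart_dom);
  chart_funK : forall g, chart_dom g -> chart_inv (chart_fun g) = g;
  chart_fun_continuous :
    forall g, chart_dom g -> {for g, continuous chart_fun};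
  chart_inv_continuous :
    forall x, (chart_fun @` chart_dom) x -> {for x, continuous chart_inv}
}.

Definition chart_img (c : chart) : set E := chart_fun c @` chart_dom c.

Definition smooth_transition (c1 c2 : chart) :=
  smooth_on (chart_fun c1 @` (chart_dom c1 `&` chart_dom c2))
            (fun x => chart_fun c2 (chart_inv c1 x)).

Definition chart_compatible (c1 c2 : chart) :=
  smooth_transition c1 c2 /\ smooth_transition c2 c1.

Record lie_group (atlas : set chart) : Prop := LieGroup {
  lie_hausdorff : hausdorff_space G;
  lie_second_countable : @second_countable G;
  lie_atlas_cover : forall g, exists2 c, atlas c & chart_dom c g;
  lie_atlas_compatible :
    forall c1 c2, atlas c1 -> atlas c2 -> chart_compatible c1 c2;
  lie_mul_continuous : continuous (fun gh : G * G => (gh.1 * gh.2)%g);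
  lie_inv_continuous : continuous (fun g : G => (g^-1)%g);
  lie_mul_smooth : forall c1 c2 c3, atlas c1 -> atlas c2 -> atlas c3 ->
    smooth_on
      [set x : E * E | [/\ chart_img c1 x.1, chart_img c2 x.2
         & chart_dom c3 (chart_inv c1 x.1 * chart_inv c2 x.2)%g]]
      (fun x => chart_fun c3 (chart_inv c1 x.1 * chart_inv c2 x.2)%g);
  lie_inv_smooth : forall c1 c2, atlas c1 -> atlas c2 ->
    smooth_on
      [set x : E | chart_img c1 x /\ chart_dom c2 ((chart_inv c1 x)^-1)%g]
      (fun x => chart_fun c2 ((chart_inv c1 x)^-1)%g)
}.

(* Membership in the maximal atlas. *)
Definition smooth_chart (atlas : set chart) (c : chart) :=
  forall c', atlas c' -> chart_compatible c c'.

(* [H] is an embedded submanifold of dimension [k]: near each of its points it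
   is the slice R^k x {0} in some smooth chart. By Cartan's theorem a closed
   subgroup satisfies this for exactly one [k]. *)
Definition has_dim (atlas : set chart) (H : set G) (k : nat) :=
  (k <= d)%N /\
  forall h, H h -> exists c : chart,
    [/\ smooth_chart atlas c, chart_dom c h &
      chart_fun c @` (chart_dom c `&` H) =
      chart_img c `&` [set x | forall i : 'I_d, (k <= i)%N -> x ord0 i = 0]].

Definition is_subgroup (H : set G) :=
  [/\ H 1%g, (forall g h, H g -> H h -> H (g * h)%g)
           & forall g, H g -> H (g^-1)%g].

Definition is_abelian (H : set G) :=
  forall g h, H g -> H h -> (g * h = h * g)%g.

Definition centralizer (A : set G) : set G :=
  [set g | forall a, A a -> (g * a = a * g)%g].

(* dim Z_G(A) = dim A *)
Definition star_subgroup (atlas : set chart) (A : set G) :=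
  [/\ is_subgroup A, closed A, is_abelian A
    & exists k, has_dim atlas (centralizer A) k /\ has_dim atlas A k].

(* The Lie algebra g_0 is the tangent space at 1, identified with R^d by a smooth
   chart [c] around 1. *)

Definition Ad (c : chart) (g : G) : E -> E :=
  'd (fun x => chart_fun c (g * chart_inv c x * g^-1)%g) (chart_fun c 1%g).

(* [X, Y] = ad(X)(Y), where ad is the differential of Ad at 1. *)
Definition lie_bracket (c : chart) (X Y : E) : E :=
  'd (fun x => Ad c (chart_inv c x) Y) (chart_fun c 1%g) X.

End LieGroup.

Section Complexification.
Variables (R : realType) (d : nat).
Local Notation E := 'rV[R]_d.
Local Notation EC := 'rV[R[i]]_d.

Definition ReV (Z : EC) : E := map_mx (@complex.Re R) Z.
Definition ImV (Z : EC) : E := map_mx (@complex.Im R) Z.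
Definition cplx (X : E) : EC := map_mx (fun r => r%:C%C) X.

(* the C-linear extension of an R-linear map *)
Definition linC (f : E -> E) (Z : EC) : EC :=
  cplx (f (ReV Z)) + 'i%C *: cplx (f (ImV Z)).

(* the C-bilinear extension of an R-bilinear map *)
Definition bilinC (b : E -> E -> E) (Z W : EC) : EC :=
  cplx (b (ReV Z) (ReV W) - b (ImV Z) (ImV W)) +
  'i%C *: cplx (b (ReV Z) (ImV W) + b (ImV Z) (ReV W)).

End Complexification.

Section Roots.
Variables (R : realType) (d : nat) (G : groupTopologicalType).
Variables (c : chart R d G) (A : set G) (n : nat).
Local Notation EC := 'rV[R[i]]_d.

Definition AdC (g : G) : EC -> EC := linC (Ad c g).

(* X^*(A) = Hom(A, U(1)): only the values of [lam] on [A] matter, so that one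
   character is represented by many functions on [G]. Continuity is automatic
   for the finite, hence discrete, groups [A] considered here. *)
Definition is_character (lam : G -> R[i]) :=
  (forall a b, A a -> A b -> lam (a * b)%g = lam a * lam b) /\
  (forall a, A a -> `|lam a| = 1).

Definition root_space (lam : G -> R[i]) : set EC :=
  [set Y | forall a, A a -> AdC a Y = lam a *: Y].

Definition is_root (alpha : G -> R[i]) :=
  [/\ is_character alpha, ~ (forall a, A a -> alpha a = 1)
    & exists2 Y, root_space alpha Y & Y != 0].

(* R_(p); p ^ logn p n is the largest power of p dividing n *)
Definition root_p (p : nat) : set (G -> R[i]) :=
  [set alpha | is_root alpha /\
               forall a, A a -> alpha a ^+ (p ^ logn p n)%N = 1].

(* For root spaces of distinct characters, the sum below is automatically direct. *)
Definition subspace_sum (I : Type) (P : set I) (V : I -> set EC) : set EC :=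
  [set x | exists m (i : 'I_m -> I) (v : 'I_m -> EC),
    (forall j, P (i j) /\ V (i j) (v j)) /\ x = \sum_j v j].

Definition g_p (p : nat) : set EC := subspace_sum (root_p p) root_space.

Definition g_prime : set EC :=
  subspace_sum [set p | prime p /\ (p %| n)%N] g_p.

End Roots.

Section LieAlgebras.
Variables (R : realType) (V : lmodType R[i]) (br : V -> V -> V).

Definition is_subspace (S : set V) :=
  S 0 /\ forall (z : R[i]) u v, S u -> S v -> S (z *: u + v).

Definition is_real_subspace (S : set V) :=
  S 0 /\ forall (r : R) u v, S u -> S v -> S (r%:C%C *: u + v).

Definition bracket_closed (S : set V) :=
  forall u v, S u -> S v -> S (br u v).

Definition is_subalgebra (L : set V) := is_subspace L /\ bracket_closed L.

Definition is_ideal (L J : set V) :=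
  [/\ is_subspace J, J `<=` L & forall u v, L u -> J v -> J (br u v)].

(* Reductive: every ideal has a complementary ideal. *)
Definition is_reductive (L : set V) :=
  forall J, is_ideal L J -> exists J',
    [/\ is_ideal L J', J `&` J' = [set 0]
      & forall u, L u -> exists v w, [/\ J v, J' w & u = v + w]].

Definition is_reductive_subalgebra (L : set V) :=
  is_subalgebra L /\ is_reductive L.

Definition is_real_form (L L0 : set V) :=
  [/\ is_real_subspace L0, bracket_closed L0, L0 `<=` L
    & forall u, L u -> exists! vw : V * V,
        [/\ L0 vw.1, L0 vw.2 & u = vw.1 + 'i%C *: vw.2]].

(* A real Lie algebra is compact when it carries an invariant inner product;
   equivalently, when it is the Lie algebra of a compact Lie group. *)
Definition is_compact_lie_algebra (L0 : set V) :=
  exists B : V -> V -> R,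
    [/\ forall (r : R) u v w, L0 u -> L0 v -> L0 w ->
          B (r%:C%C *: u + v) w = r * B u w + B v w,
        forall u v, L0 u -> L0 v -> B u v = B v u,
        forall u, L0 u -> u != 0 -> 0 < B u u
      & forall u v w, L0 u -> L0 v -> L0 w -> B (br u v) w = - B v (br u w)].

Definition is_compact_real_form (L L0 : set V) :=
  is_real_form L L0 /\ is_compact_lie_algebra L0.

End LieAlgebras.

(* Main.v *)
(** A finite star-subgroup A fixes no nonzero vector of g_0. Indeed A and its
    centralizer are then 0-dimensional, so 1 is isolated in the centralizer; but
    averaging a chart over the conjugation action of A gives a local
    diffeomorphism at 1 that intertwines conjugation with Ad, so that a fixed
    vector Y would produce elements of the centralizer close to 1.

    Compactness gives an Ad-invariant inner product, hence an invariant Hermitian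
    form on g. A subalgebra of g that is stable under complex conjugation is
    reductive, by taking orthogonal complements of ideals, and its real points
    are a compact real form.

    It remains to see that g' is a subalgebra. Roots of the same prime cause no
    problem. For roots alpha, beta of coprime orders we show that
    [g_alpha, g_beta] = 0. Let Z = [X, Y] have weight gamma = alpha + beta. Then
    [Z, conj Z] has weight 0 and vanishes, so ad Z is normal. As alpha = j gamma
    for some j, ad(Z)^j maps conj X into the weight 0 space, so [Z, conj X] = 0
    by normality, and |Z|^2 = -<Y, [conj X, Z]> = 0. *)
Require Import Defs.
From HB Require Import structures.
From mathcomp Require Import all_boot all_order all_algebra.
From mathcomp Require Import complex.
From mathcomp Require Import all_classical all_reals all_analysis.
From mathcomp Require Import ring lra.

Set Implicit Arguments.
Unset Strict Implicit.
Unset Printing Implicit Defensive.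

Import Order.TTheory GRing.Theory Num.Theory.
Import numFieldNormedType.Exports.

Local Open Scope classical_set_scope.
Local Open Scope ring_scope.

(** * Differential calculus and C^k functions *)

(** The Lie algebra is a coordinate space whose bracket is a second derivative in one chart, so the
    axioms of a Lie algebra have to be proved. The Jacobi identity and the invariance of the inner
    product are derivatives at 1 of identities satisfied by Ad; antisymmetry rests on the symmetry
    of the second derivatives of the multiplication, whence the calculus of C^k maps.

    The invariant inner product is obtained without Haar measure: a strictly convex invariant
    function on positive forms, with compact sublevel sets, has only one minimizer, which is
    therefore fixed by the group.

    The obstacle to closure under the bracket is a pair of roots for distinct primes p and q: their
    sum could be a root of order divisible by both primes, whose root space lies outside g'. This is
    why such brackets have to vanish altogether. The multiplier j is the Chinese remainder solution
    of j = 1 modulo the power of p and j = 0 modulo the power of q. For a single prime, a nonzero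
    bracket has a weight killed by the same power of p, and this weight is nontrivial because A
    fixes no nonzero vector. *)

Section Differentials.
Variable R : realType.
Implicit Types U V W : normedModType R.

(** Transfers derivatives between functions with the same germ. Chart expressions are total
    functions with arbitrary values far away, so most identities between them hold only near a
    point. *)
Lemma near_eq_diff V W (f g : V -> W) x :
  {near x, f =1 g} -> differentiable f x ->
  differentiable g x /\ 'd g x = 'd f x :> (V -> W).
Proof.
move=> fg df.
have key : g \o shift x = cst (g x) + 'd f x +o_ 0 id.
  apply/eqaddoP => e e0.
  have /eqaddoP/(_ _ e0) := diff_locally df.
  rewrite -(nbhs_singleton fg).
  have : \forall h \near (0 : V), f (h + x) = g (h + x).
    by have := fg; rewrite (near_shift 0)/= subr0.
  by apply: filterS2 => h /= hfg; rewrite !fctE /= hfg.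
have E : 'd g x = 'd f x :> (V -> W).
  by apply: diff_unique => //; exact: diff_continuous.
by split=> //; apply/diff_locallyP; rewrite E; split => //; exact: diff_continuous.
Qed.

Lemma scale_is_bilinear W :
  bilinear_for
    (GRing.Scale.Law.clone _ _ *:%R _) (GRing.Scale.Law.clone _ _ *:%R _)
    (@GRing.scale R W).
Proof.
split=> [u'|u] a x y /=.
- by rewrite scalerDl scalerA.
- by rewrite scalerDr !scalerA mulrC.
Qed.

Lemma diff_scale V W (s : V -> R) (f : V -> W) x :
  differentiable s x -> differentiable f x ->
  differentiable (fun y => s y *: f y) x /\
  forall v, 'd (fun y => s y *: f y) x v = s x *: 'd f x v + 'd s x v *: f x.
Proof.
move=> ds df.
pose bM := bilinear_isBilinear.Build R R W W _ _ (@GRing.scale R W) (@scale_is_bilinear W).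
pose b : {bilinear R -> W -> W} := HB.pack (@GRing.scale R W) bM.
have bc : continuous (fun p : R * W => b p.1 p.2).
  by move=> p; apply: scale_continuous.
have -> : (fun y => s y *: f y) = (fun p : R * W => b p.1 p.2) \o (fun y => (s y, f y)) by [].
split.
  apply: differentiable_comp; first exact: differentiable_pair.
  exact: differentiable_bilin.
move=> v; rewrite diff_comp /=; last 2 first.
- exact: differentiable_pair.
- exact: (differentiable_bilin (f := b)).
by rewrite (diff_bilin (f := b)) // diff_pair.
Qed.

Lemma diff_lincomp U V W (f : U -> V) (l : {linear V -> W}) x :
  continuous l -> differentiable f x ->
  differentiable (l \o f) x /\ forall v, 'd (l \o f) x v = l ('d f x v).
Proof.
move=> cl df; have dl := linear_differentiable (f x) cl.
split=> [|v]; first exact: differentiable_comp.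
by rewrite [LHS](congr1 (fun h => h v) (diff_comp df dl)) /= diff_lin.
Qed.

Lemma diff_compE U V W (f : U -> V) (g : V -> W) x v :
  differentiable f x -> differentiable g (f x) ->
  'd (g \o f) x v = 'd g (f x) ('d f x v).
Proof. by move=> df dg; exact: (congr1 (fun h => h v) (diff_comp df dg)). Qed.

Lemma near_diffE V W (f g : V -> W) x v :
  {near x, f =1 g} -> differentiable f x -> 'd g x v = 'd f x v.
Proof. by move=> fg /(near_eq_diff fg)[_ E]; exact: (congr1 (fun h => h v) E). Qed.

Lemma diff_idE V (x v : V) : 'd (fun z : V => z) x v = v.
Proof. by rewrite (@diff_lin _ _ _ idfun) // => y; exact: cvg_id. Qed.

Lemma diff_constE V W (w : W) (x v : V) : 'd (fun _ : V => w) x v = 0.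
Proof. exact: (congr1 (fun h => h v) (diff_cst w x)). Qed.

Lemma diff_translate V (x w : V) :
  differentiable (fun y => y + w) x /\ forall v, 'd (fun y => y + w) x v = v.
Proof.
have di : differentiable (@idfun V) x by apply: linear_differentiable => y; exact: cvg_id.
have dc := differentiable_cst w x.
split=> [|v]; first exact: (differentiableD di dc).
rewrite [LHS](congr1 (fun h => h v) (diffD di dc)).
rewrite -[LHS]/('d idfun x v + 'd (cst w) x v) diff_cst addr0.
by rewrite [LHS](congr1 (fun h => h v) (@diff_lin _ _ _ idfun x _)) // => y; exact: cvg_id.
Qed.

Lemma diff_line V (x u : V) (r : R) :
  differentiable (fun t : R => x + t *: u) r /\
  'd (fun t : R => x + t *: u) r 1 = u.
Proof.
have [ds dsE] := is_diff_scalel r u.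
have dc := @differentiable_cst _ R V x r.
split; first exact: (differentiableD dc ds).
rewrite [LHS](congr1 (fun h => h 1) (diffD dc ds)).
rewrite -[LHS]/('d (cst x) r 1 + 'd ( *:%R ^~ u) r 1) diff_cst add0r.
by rewrite dsE scale1r.
Qed.

End Differentials.

Section CkTheory.
Variable R : realType.
Implicit Types V W : normedModType R.

Lemma Ck_sub k V W (U U' : set V) (f : V -> W) :
  U' `<=` U -> Ck k U f -> Ck k U' f.
Proof.
elim: k f => [|k IH] f UU /=; first by move=> h x /UU /h.
move=> [h1 h2]; split=> [x /UU /h1//|v]; exact: IH (h2 v).
Qed.

Lemma Ck_eq k V W (U : set V) (f g : V -> W) : open U ->
  (forall x, U x -> f x = g x) -> Ck k U f -> Ck k U g.
Proof.
move=> oU; elim: k f g => [|k IH] f g fg /=.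
  move=> h x Ux; have := h x Ux; rewrite /prop_for /continuous_at -fg //.
  apply: cvg_trans; apply: near_eq_cvg.
  by apply: filterS (open_nbhs_nbhs (conj oU Ux)) => y /fg.
have nfg x : U x -> {near x, f =1 g}.
  by move=> Ux; apply: filterS (open_nbhs_nbhs (conj oU Ux)) => y /fg.
move=> [h1 h2]; split=> [x Ux|v].
  by have [] := near_eq_diff (nfg x Ux) (h1 x Ux).
apply: IH (h2 v) => x Ux.
by have [_ ->] := near_eq_diff (nfg x Ux) (h1 x Ux).
Qed.

Lemma Ck_leS k V W (U : set V) (f : V -> W) : Ck k.+1 U f -> Ck k U f.
Proof.
elim: k f => [|k IH] f.
  by move=> [h _] x Ux; apply: differentiable_continuous; exact: h.
by move=> [h1 h2]; split => // v; apply: IH; exact: h2.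
Qed.

Lemma Ck_cst k V W (U : set V) (w : W) : Ck k U (cst w).
Proof.
elim: k w => [|k IH] w; first by move=> x _; exact: cst_continuous.
split=> [x _|v]; first exact: differentiable_cst.
rewrite (_ : (fun x => _) = cst 0) //.
by rewrite funeqE => x; rewrite diff_cst.
Qed.

Lemma Ck_linear k V W (U : set V) (f : {linear V -> W}) :
  continuous f -> Ck k U f.
Proof.
move=> fc; case: k => [|k]; first by move=> x _; exact: fc.
split=> [x _|v]; first exact: linear_differentiable.
rewrite (_ : (fun x => _) = cst (f v)); first exact: Ck_cst.
by rewrite funeqE => x; rewrite diff_lin.
Qed.

Lemma CkD k V W (U : set V) (f g : V -> W) : open U ->
  Ck k U f -> Ck k U g -> Ck k U (f \+ g).
Proof.
move=> oU; elim: k f g => [|k IH] f g.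
  by move=> hf hg x Ux; apply: continuousD; [exact: hf|exact: hg].
move=> [f1 f2] [g1 g2]; split=> [x Ux|v].
  by apply: differentiableD; [exact: f1|exact: g1].
apply: (Ck_eq oU) (IH _ _ (f2 v) (g2 v)) => x Ux.
by rewrite (diffD (f1 x Ux) (g1 x Ux)).
Qed.

Lemma Ck_scale k V W (U : set V) (s : V -> R) (f : V -> W) : open U ->
  Ck k U s -> Ck k U f -> Ck k U (fun x => s x *: f x).
Proof.
move=> oU; elim: k s f => [|k IH] s f.
  move=> hf hg x Ux; have := (@continuousZ _ _ _ s f x) _ _; apply.
    exact: hf.
  exact: hg.
move=> Cs Cf; have [[f1 f2] [g1 g2]] := (Cs, Cf); split=> [x Ux|v].
  by have [] := diff_scale (f1 x Ux) (g1 x Ux).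
apply: (Ck_eq oU) (CkD oU (IH _ _ (Ck_leS Cs) (g2 v)) (IH _ _ (f2 v) (Ck_leS Cf))).
by move=> x Ux /=; have [_ ->] := diff_scale (f1 x Ux) (g1 x Ux).
Qed.

Lemma Ck_sum k V W (U : set V) n (f : 'I_n -> V -> W) : open U ->
  (forall i, Ck k U (f i)) -> Ck k U (fun x => \sum_i f i x).
Proof.
move=> oU; elim: n f => [|n IH] f Cf.
  apply: (Ck_eq oU) (@Ck_cst k V W U 0) => x _; by rewrite big_ord0.
apply: (Ck_eq oU) (CkD oU (Cf ord0) (IH _ (fun i => Cf (lift ord0 i)))).
by move=> x _ /=; rewrite big_ord_recl.
Qed.

Lemma Ck_lincomp k V W W' (U : set V) (f : V -> W) (l : {linear W -> W'}) :
  open U -> continuous l -> Ck k U f -> Ck k U (l \o f).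
Proof.
move=> oU cl; elim: k f => [|k IH] f.
  move=> h x Ux; apply: continuous_comp; [exact: h|exact: cl].
move=> [f1 f2]; split=> [x Ux|v].
  by apply: differentiable_comp; [exact: f1|exact: linear_differentiable].
apply: (Ck_eq oU) (IH _ (f2 v)) => x Ux /=.
by rewrite [in RHS]diff_comp ?diff_lin//; [exact: f1|exact: linear_differentiable].
Qed.

Lemma sum_continuous_at V W n (f : 'I_n -> V -> W) x :
  (forall i, {for x, continuous (f i)}) ->
  {for x, continuous (fun y => \sum_i f i y)}.
Proof.
elim: n f => [|n IH] f fc.
  rewrite (_ : (fun y => _) = cst 0); first exact: cst_continuous.
  by rewrite funeqE => y; rewrite big_ord0.
rewrite (_ : (fun y => _) = f ord0 \+ (fun y => \sum_i f (lift ord0 i) y)).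
  by apply: continuousD; [exact: fc|apply: IH].
by rewrite funeqE => y; rewrite big_ord_recl.
Qed.

Lemma sum_continuous V W n (f : 'I_n -> V -> W) :
  (forall i, continuous (f i)) -> continuous (fun x => \sum_i f i x).
Proof. by move=> fc x; apply: sum_continuous_at => i; exact: fc. Qed.

(** Finite dimension in the form of continuous coordinates. [Ck] controls derivatives along fixed
    vectors, and a moving direction is reduced to these by expanding it in [b]. *)
Definition fin_basis W := exists n (b : 'I_n -> W) (l : 'I_n -> {linear W -> R}),
  (forall i, continuous (l i)) /\ forall w, w = \sum_i l i w *: b i.

(** The chain rule produces ['d g (f x) ('d f x v)], whose direction moves with [x]. In the finite
    basis it becomes a sum of products of [l i ('d f x v)] and ['d g (f x) (b i)], and the induction
    hypothesis applies to the second factor. *)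
Lemma Ck_comp k V W W' (U : set V) (U' : set W) (f : V -> W) (g : W -> W') :
  fin_basis W -> open U -> (forall x, U x -> U' (f x)) ->
  Ck k U f -> Ck k U' g -> Ck k U (g \o f).
Proof.
move=> [n [b [l [lc lb]]]] oU fU; elim: k f g fU => [|k IH] f g fU.
  by move=> hf hg x Ux; apply: continuous_comp; [exact: hf|apply: hg; exact: fU].
move=> Cf Cg; have [[f1 f2] [g1 g2]] := (Cf, Cg); split=> [x Ux|v].
  by apply: differentiable_comp; [exact: f1|apply: g1; exact: fU].
have := @Ck_sum k V W' U n (fun i x => l i ('d f x v) *: 'd g (f x) (b i)) oU.
move=> H; apply: (Ck_eq oU) (H _) => [x Ux|i] /=.
  rewrite [in RHS]diff_comp /=; [|exact: f1|apply: g1; exact: fU].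
  rewrite {2}(lb ('d f x v)) linear_sum.
  by apply: eq_bigr => i _; rewrite linearZ.
apply: Ck_scale => //; first exact: Ck_lincomp (f2 v).
by have := IH f _ fU (Ck_leS Cf) (g2 (b i)).
Qed.

Lemma Ck_pair k V W W' (U : set V) (f : V -> W) (g : V -> W') : open U ->
  Ck k U f -> Ck k U g -> Ck k U (fun x => (f x, g x)).
Proof.
move=> oU; elim: k f g => [|k IH] f g.
  by move=> hf hg x Ux; apply: cvg_pair; [exact: hf|exact: hg].
move=> [f1 f2] [g1 g2]; split=> [x Ux|v].
  by apply: differentiable_pair; [exact: f1|exact: g1].
apply: (Ck_eq oU) (IH _ _ (f2 v) (g2 v)) => x Ux.
by rewrite (diff_pair (f1 x Ux) (g1 x Ux)).
Qed.

End CkTheory.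

(** * Smooth maps into a Lie group *)

Section FinBasis.
Variable R : realType.

Lemma fin_basis_rV d : fin_basis 'rV[R]_d.
Proof.
pose f (i : 'I_d) (v : 'rV[R]_d) : R := v ord0 i.
have fl i : linear (f i) by move=> a u v; rewrite /f !mxE.
pose fL i : {linear 'rV[R]_d -> R} :=
  HB.pack (f i) (GRing.isLinear.Build _ _ _ _ _ (fl i)).
exists d, (fun i => delta_mx ord0 i), fL; split.
  by move=> i; exact: coord_continuous.
by move=> w; rewrite {1}(row_sum_delta w).
Qed.

Lemma fin_basis_prod (V W : normedModType R) :
  fin_basis V -> fin_basis W -> fin_basis (V * W)%type.
Proof.
move=> [m [b [l [lc lb]]]] [n [b' [l' [lc' lb']]]].
pose bb (i : 'I_(m + n)) : V * W :=
  match fintype.split i with inl j => (b j, 0) | inr j => (0, b' j) end.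
pose ll (i : 'I_(m + n)) (p : V * W) : R :=
  match fintype.split i with inl j => l j p.1 | inr j => l' j p.2 end.
have lll i : linear (ll i).
  by move=> a u v; rewrite /ll; case: fintype.split => j; rewrite linearP.
pose L i : {linear (V * W)%type -> R} :=
  HB.pack (ll i) (GRing.isLinear.Build _ _ _ _ _ (lll i)).
exists (m + n)%N, bb, L; split.
  move=> i; change (continuous (ll i)); rewrite /ll; case: fintype.split => j p.
    by apply: continuous_comp; [exact: cvg_fst|exact: lc].
  by apply: continuous_comp; [exact: cvg_snd|exact: lc'].
move=> [v w]; rewrite big_split_ord /=.
have E1 i : ll (lshift n i) (v, w) *: bb (lshift n i) = (l i v *: b i, 0).
  rewrite /ll /bb; case: splitP => j /= ij.
    have -> : j = i by exact: val_inj.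
    by apply: (congr1 (pair _)); exact: scaler0.
  by have := ltn_ord i; rewrite ij ltnNge leq_addr.
have E2 i : ll (rshift m i) (v, w) *: bb (rshift m i) = (0, l' i w *: b' i).
  rewrite /ll /bb; case: splitP => j /= ij.
    by have := ltn_ord j; rewrite -ij ltnNge leq_addr.
  have -> : j = i by apply: val_inj; move/addnI: ij.
  by apply: (congr1 (fun x => (x, _))); exact: scaler0.
rewrite (eq_bigr _ (fun i _ => E1 i)) (eq_bigr _ (fun i _ => E2 i)).
have S1 : \sum_i (l i v *: b i, 0 : W) = (v, 0).
  rewrite {2}(lb v); elim/big_ind2 : _ => // x1 x2 y1 y2 -> ->.
  by apply: (congr1 (pair _)); exact: addr0.
have S2 : \sum_i (0 : V, l' i w *: b' i) = (0, w).
  rewrite {2}(lb' w); elim/big_ind2 : _ => // x1 x2 y1 y2 -> ->.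
  by apply: (congr1 (fun x => (x, _))); exact: addr0.
rewrite S1 S2; apply/esym.
by rewrite -[LHS]/(v + 0, 0 + w) addr0 add0r.
Qed.

End FinBasis.

Section SmoothAt.
Variable R : realType.
Implicit Types V W : normedModType R.

(** One neighbourhood serves all orders [k]. *)
Definition smooth_at V W (f : V -> W) (x : V) :=
  exists U, [/\ open U, U x & smooth_on U f].

Lemma near_open (T : topologicalType) (x : T) (P : T -> Prop) :
  (\forall y \near x, P y) -> exists U, [/\ open U, U x & forall y, U y -> P y].
Proof.
move=> nP; exists (interior P); split => //; first exact: open_interior.
exact: interior_subset.
Qed.

Lemma smooth_at_near_eq V W (f g : V -> W) x :
  {near x, f =1 g} -> smooth_at f x -> smooth_at g x.
Proof.
move=> /near_open[U' [oU' U'x fg]] [U [oU Ux sf]].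
exists (U `&` U'); split; [exact: openI|by split|move=> k].
apply: (Ck_eq (f := f)); first exact: openI.
  by move=> y [_ /fg].
by apply: Ck_sub (sf k); exact: subIsetl.
Qed.

Lemma smooth_at_near V W (f : V -> W) x :
  smooth_at f x -> \forall y \near x, smooth_at f y.
Proof.
move=> [U [oU Ux sf]].
by apply: filterS (open_nbhs_nbhs (conj oU Ux)) => y Uy; exists U.
Qed.

Lemma smooth_at_diff V W (f : V -> W) x : smooth_at f x -> differentiable f x.
Proof. by move=> [U [oU Ux sf]]; have [+ _] := sf 1%N; exact. Qed.

Lemma smooth_at_cont V W (f : V -> W) x : smooth_at f x -> {for x, continuous f}.
Proof. by move=> /smooth_at_diff/differentiable_continuous. Qed.

Lemma smooth_at_d V W (f : V -> W) x v :
  smooth_at f x -> smooth_at (fun y => 'd f y v) x.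
Proof.
move=> [U [oU Ux sf]]; exists U; split => // k.
by have [_ +] := sf k.+1; exact.
Qed.

Lemma smooth_at_comp_on V W W' (f : V -> W) (g : W -> W') (U' : set W) x :
  fin_basis W -> smooth_at f x -> (\forall y \near x, U' (f y)) ->
  smooth_on U' g -> smooth_at (g \o f) x.
Proof.
move=> bW [U [oU Ux sf]] /near_open[U2 [oU2 U2x fU]] sg.
exists (U `&` U2); split; [exact: openI|by split|move=> k].
apply: (Ck_comp (U' := U') bW); first exact: openI.
- by move=> y [_ /fU].
- by apply: Ck_sub (sf k); exact: subIsetl.
- exact: sg.
Qed.

Lemma smooth_at_comp V W W' (f : V -> W) (g : W -> W') x :
  fin_basis W -> smooth_at f x -> smooth_at g (f x) -> smooth_at (g \o f) x.
Proof.
move=> bW sf [U [oU Ux sg]]; apply: (smooth_at_comp_on bW sf _ sg).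
exact: (smooth_at_cont sf) (open_nbhs_nbhs (conj oU Ux)).
Qed.

Lemma smooth_at_pair V W W' (f : V -> W) (g : V -> W') x :
  smooth_at f x -> smooth_at g x -> smooth_at (fun y => (f y, g y)) x.
Proof.
move=> [U [oU Ux sf]] [U' [oU' U'x sg]].
exists (U `&` U'); split; [exact: openI|by split|move=> k].
apply: Ck_pair; first exact: openI.
  by apply: Ck_sub (sf k); exact: subIsetl.
by apply: Ck_sub (sg k); exact: subIsetr.
Qed.

Lemma smooth_at_linear V W (f : {linear V -> W}) x :
  continuous f -> smooth_at f x.
Proof.
move=> cf; exists setT; split => //; first exact: openT.
by move=> k; exact: Ck_linear.
Qed.

Lemma smooth_at_lincomp V W W' (f : V -> W) (l : {linear W -> W'}) x :
  continuous l -> smooth_at f x -> smooth_at (l \o f) x.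
Proof.
by move=> cl [U [oU Ux sf]]; exists U; split => // k; apply: Ck_lincomp (sf k).
Qed.

Lemma smooth_at_cst V W (w : W) (x : V) : smooth_at (fun=> w) x.
Proof.
exists setT; split => //; first exact: openT.
by move=> k; exact: Ck_cst.
Qed.

Lemma smooth_at_id V (x : V) : smooth_at (fun y => y) x.
Proof. by apply: (@smooth_at_linear V V idfun) => y; exact: cvg_id. Qed.

Lemma smooth_atD V W (f g : V -> W) x :
  smooth_at f x -> smooth_at g x -> smooth_at (f \+ g) x.
Proof.
move=> [U [oU Ux sf]] [U' [oU' U'x sg]].
exists (U `&` U'); split; [exact: openI|by split|move=> k].
apply: CkD; first exact: openI.
  by apply: Ck_sub (sf k); exact: subIsetl.
by apply: Ck_sub (sg k); exact: subIsetr.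
Qed.

Lemma smooth_at_fst V W W' (f : V -> W * W') x :
  smooth_at f x -> smooth_at (fun y => (f y).1) x.
Proof.
by move=> sf; apply: (@smooth_at_lincomp _ _ _ f fst) => // p; exact: cvg_fst.
Qed.

Lemma smooth_at_snd V W W' (f : V -> W * W') x :
  smooth_at f x -> smooth_at (fun y => (f y).2) x.
Proof.
by move=> sf; apply: (@smooth_at_lincomp _ _ _ f snd) => // p; exact: cvg_snd.
Qed.

End SmoothAt.

Section GroupValued.
Variables (R : realType) (d : nat) (G : groupTopologicalType).
Variables (atlas : set (chart R d G)) (HG : lie_group atlas).
Implicit Types (V W : normedModType R) (c : chart R d G).

(** Continuity is part of the definition: where [F] leaves the domain of [a], the values of
    [chart_fun a] are arbitrary, and smoothness of the composite says nothing about [F]. *)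
Definition Gsmooth V (F : V -> G) (v : V) :=
  {for v, continuous F} /\
  exists2 a, atlas a & chart_dom a (F v) /\ smooth_at (chart_fun a \o F) v.

(** Near each of its points the image coincides with the preimage of [U] under the continuous
    [chart_inv c]. *)
Lemma chart_image_open c (U : set G) : open U ->
  open (chart_fun c @` (chart_dom c `&` U)).
Proof.
move=> oU; rewrite openE => _ [g [cg Ug] <-]; rewrite /interior.
have ic : (chart_fun c @` chart_dom c) (chart_fun c g) by exists g.
have oc := open_nbhs_nbhs (conj (@chart_img_open _ _ _ c) ic).
have := chart_inv_continuous ic; rewrite /prop_for /continuous_at chart_funK //.
move=> /(_ _ (open_nbhs_nbhs (conj oU Ug))) /= H.
apply: filterS2 oc H => _ [h ch <-] /=; rewrite chart_funK // => Uh.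
by exists h.
Qed.

(** The atlas chart [a] witnessing smoothness is exchanged for [c] by composing with the transition
    map near [v]. *)
Lemma Gsmooth_chart V (F : V -> G) v c : smooth_chart atlas c ->
  chart_dom c (F v) -> Gsmooth F v -> smooth_at (chart_fun c \o F) v.
Proof.
move=> sc cv [Fc [a aa [av sa]]].
have nF U : open U -> U (F v) -> \forall y \near v, U (F y).
  by move=> oU Uv; exact: Fc (open_nbhs_nbhs (conj oU Uv)).
have na := nF _ (chart_dom_open a) av; have nc := nF _ (chart_dom_open c) cv.
apply: (@smooth_at_near_eq _ _ _
   ((fun x => chart_fun c (chart_inv a x)) \o (chart_fun a \o F))).
  by apply: filterS na => y ay /=; rewrite chart_funK.
apply: (@smooth_at_comp_on _ _ _ _ _ _ (chart_fun a @` (chart_dom a `&` chart_dom c))) => //.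
- exact: fin_basis_rV.
- by apply: filterS2 na nc => y ay cy /=; exists (F y).
- by have [] := sc a aa.
Qed.

Lemma Gsmooth_chart_inv c x : smooth_chart atlas c -> chart_img c x ->
  Gsmooth (chart_inv c) x.
Proof.
move=> sc ix; split; first exact: chart_inv_continuous.
have [a aa av] := lie_atlas_cover HG (chart_inv c x); exists a => //.
split=> //; exists (chart_fun c @` (chart_dom c `&` chart_dom a)).
split.
- by apply: chart_image_open; exact: chart_dom_open.
- case: ix av => g cg <-; rewrite chart_funK // => ag; by exists g.
- by have [+ _] := sc a aa.
Qed.

Lemma Gsmooth_cst V (g : G) (v : V) : Gsmooth (fun=> g) v.
Proof.
split; first exact: cst_continuous.
have [a aa av] := lie_atlas_cover HG g; exists a => //; split=> //.
exact: smooth_at_cst.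
Qed.

Lemma Gsmooth_comp V W (f : V -> W) (F : W -> G) v : fin_basis W ->
  smooth_at f v -> Gsmooth F (f v) -> Gsmooth (F \o f) v.
Proof.
move=> bW sf [Fc [a aa [av sa]]]; split.
  by apply: continuous_comp => //; exact: smooth_at_cont.
by exists a => //; split => //; exact: (smooth_at_comp bW sf sa).
Qed.

Lemma Gsmooth_mul V (F H : V -> G) v : Gsmooth F v -> Gsmooth H v ->
  Gsmooth (fun x => (F x * H x)%g) v.
Proof.
move=> [Fc [a aa [av sa]]] [Hc [b bb [bv sb]]].
have Mc : {for v, continuous (fun x => (F x * H x)%g)}.
  apply: (@continuous_comp _ _ _ (fun x => (F x, H x)) (fun gh : G * G => (gh.1 * gh.2)%g)).
    by apply: cvg_pair.
  exact: lie_mul_continuous HG _.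
split=> //.
have [e ee ev] := lie_atlas_cover HG (F v * H v)%g; exists e => //; split=> //.
have na : \forall y \near v, chart_dom a (F y).
  exact: Fc (open_nbhs_nbhs (conj (chart_dom_open a) av)).
have nb : \forall y \near v, chart_dom b (H y).
  exact: Hc (open_nbhs_nbhs (conj (chart_dom_open b) bv)).
have ne : \forall y \near v, chart_dom e (F y * H y)%g.
  exact: Mc (open_nbhs_nbhs (conj (chart_dom_open e) ev)).
have := lie_mul_smooth HG aa bb ee; set U' := (X in smooth_on X _) => sU.
apply: smooth_at_near_eq; last first.
  apply: (smooth_at_comp_on _ (smooth_at_pair sa sb) _ sU).
    by apply: fin_basis_prod; exact: fin_basis_rV.
  apply: filterS3 na nb ne => y ya yb ye; rewrite /U' /=.
  by rewrite !chart_funK //; split => //; eexists; eauto.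
by apply: filterS2 na nb => y ya yb /=; rewrite !chart_funK.
Qed.

Lemma Gsmooth_inv V (F : V -> G) v : Gsmooth F v ->
  Gsmooth (fun x => (F x)^-1%g) v.
Proof.
move=> [Fc [a aa [av sa]]].
have Mc : {for v, continuous (fun x => (F x)^-1%g)}.
  apply: (@continuous_comp _ _ _ F (fun g : G => (g^-1)%g)) => //.
  exact: lie_inv_continuous HG _.
split=> //.
have [e ee ev] := lie_atlas_cover HG (F v)^-1%g; exists e => //; split=> //.
have na : \forall y \near v, chart_dom a (F y).
  exact: Fc (open_nbhs_nbhs (conj (chart_dom_open a) av)).
have ne : \forall y \near v, chart_dom e (F y)^-1%g.
  exact: Mc (open_nbhs_nbhs (conj (chart_dom_open e) ev)).
have := lie_inv_smooth HG aa ee; set U' := (X in smooth_on X _) => sU.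
apply: smooth_at_near_eq; last first.
  apply: (smooth_at_comp_on _ sa _ sU); first exact: fin_basis_rV.
  apply: filterS2 na ne => y ya ye; rewrite /U' /=.
  by rewrite !chart_funK //; split => //; eexists; eauto.
by apply: filterS na => y ya /=; rewrite !chart_funK.
Qed.

End GroupValued.

(** * Symmetry of second derivatives *)

Section MeanValue.
Variable R : realType.
Implicit Types V W : normedModType R.

Lemma is_derive_line V W (f : V -> W) (x u : V) (r : R) :
  differentiable f (x + r *: u) ->
  is_derive r 1 (fun t : R => f (x + t *: u)) ('d f (x + r *: u) u).
Proof.
move=> df.
have [dl dl1] := diff_line x u r.
have dc : differentiable (f \o (fun t : R => x + t *: u)) r.
  exact: differentiable_comp.
apply: DeriveDef; first exact: diff_derivable.
rewrite deriveE // [LHS](_ : _ = 'd (f \o (fun t : R => x + t *: u)) r 1) //.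
by rewrite [LHS](congr1 (fun h => h 1) (diff_comp dl df)) /= dl1.
Qed.

Lemma MVT_line V (f : V -> R) (x u : V) (h : R) : 0 < h ->
  (forall r, 0 <= r <= h -> differentiable f (x + r *: u)) ->
  exists2 r, 0 <= r <= h & f (x + h *: u) - f x = h * 'd f (x + r *: u) u.
Proof.
move=> h0 df.
have D r : r \in `]0, h[ ->
    is_derive r 1 (fun t : R => f (x + t *: u)) ('d f (x + r *: u) u).
  by rewrite in_itv /= => /andP[r0 rh]; apply: is_derive_line; apply: df; rewrite !ltW.
have C : {within `[0, h], continuous (fun t : R => f (x + t *: u))}.
  apply: continuous_in_subspaceT => r; rewrite inE /= in_itv /= => rh.
  apply: differentiable_continuous; apply/derivable1_diffP.
  by have [] := is_derive_line (df r rh).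
have [r rin E] := MVT h0 D C.
exists r; first by move: rin; rewrite in_itv /= => /andP[? ?]; rewrite !ltW.
by move: E; rewrite scale0r addr0 subr0 mulrC.
Qed.

(** The mean value theorem is used twice: along [u] for f(y + h v) - f(y), then along [v] for the
    derivative of [f] in direction [u]. *)
Lemma second_difference V (U : set V) (f : V -> R) (x u v : V) (h : R) :
  open U -> smooth_on U f -> 0 < h ->
  (forall r s, 0 <= r <= h -> 0 <= s <= h -> U (x + r *: u + s *: v)) ->
  exists r s, [/\ 0 <= r <= h, 0 <= s <= h &
   f (x + h *: u + h *: v) - f (x + h *: u) - f (x + h *: v) + f x =
   h * h * 'd (fun y => 'd f y u) (x + r *: u + s *: v) v].
Proof.
move=> oU sf h0 inU.
have dU y : U y -> differentiable f y by have [+ _] := sf 1%N; exact.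
have dU2 y : U y -> differentiable (fun z => 'd f z u) y.
  by have [_ /(_ u)[+ _]] := sf 2%N; exact.
have h00 : (0 : R) <= 0 <= h by rewrite lexx ltW.
have hh : 0 <= h <= h by rewrite lexx ltW.
pose g y := f (y + h *: v) - f y.
have dg r : 0 <= r <= h -> differentiable g (x + r *: u) /\
    forall w, 'd g (x + r *: u) w = 'd f (x + r *: u + h *: v) w - 'd f (x + r *: u) w.
  move=> rh.
  have d1 := dU _ (inU r h rh hh); have d0 := dU _ (inU r 0 rh h00).
  rewrite scale0r addr0 in d0.
  have [dt dtE] := diff_translate (x + r *: u) (h *: v).
  have dc : differentiable (f \o (fun y => y + h *: v)) (x + r *: u).
    exact: differentiable_comp.
  split=> [|w]; first exact: (differentiableB dc d0).
  rewrite [LHS](congr1 (fun h => h w) (diffB dc d0)).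
  congr (_ - _); rewrite [LHS](congr1 (fun h => h w) (diff_comp dt d1)).
  by rewrite /= dtE.
have [r rh E1] := @MVT_line _ g x u h h0 (fun r rh => (dg r rh).1).
have [s sh E2] := @MVT_line _ (fun y => 'd f y u) (x + r *: u) v h h0
  (fun s sh => dU2 _ (inU r s rh sh)).
exists r, s; split => //.
rewrite -mulrA -E2.
move: E1; rewrite (dg r rh).2 => E1.
by rewrite -E1 /g opprB addrA [RHS]addrAC.
Qed.

(** The second difference is symmetric in [u] and [v]; divided by h^2, it is the value of either
    mixed derivative at some nearby point, and continuity brings both to [x]. *)
Lemma Schwarz_scalar V (f : V -> R) (x u v : V) : smooth_at f x ->
  'd (fun y => 'd f y u) x v = 'd (fun y => 'd f y v) x u.
Proof.
move=> sf; have [U [oU Ux sU]] := sf.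
pose a y := 'd (fun z => 'd f z u) y v; pose b y := 'd (fun z => 'd f z v) y u.
have ca : {for x, continuous a} by apply: smooth_at_cont; do 2!apply: smooth_at_d.
have cb : {for x, continuous b} by apply: smooth_at_cont; do 2!apply: smooth_at_d.
apply/subr0_eq/normr0_eq0/eqP; rewrite eq_le normr_ge0 andbT.
apply/ler_addgt0Pl => eps eps0; rewrite addr0.
have e2 : 0 < eps / 2 by rewrite divr_gt0.
have na : \forall y \near x, ball (a x) (eps/2) (a y) := ca _ (nbhsx_ballx (a x) _ e2).
have nb : \forall y \near x, ball (b x) (eps/2) (b y) := cb _ (nbhsx_ballx (b x) _ e2).
have [del /= del0 H] : exists2 del, 0 < del & forall y, ball x del y ->
   [/\ U y, ball (a x) (eps/2) (a y) & ball (b x) (eps/2) (b y)].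
  have H : nbhs x (U `&` [set y | ball (a x) (eps/2) (a y) /\ ball (b x) (eps/2) (b y)]).
    by apply: filterI; [exact: open_nbhs_nbhs|exact: filterI].
  case/nbhs_ballP: H => [del /= del0 dP]; by exists del => // y /dP [? [? ?]].
(* With [h = del / N / 2] below, the parallelogram with sides [h *: u] and [h *: v] stays in the
   ball of radius [del]. The summand 1 keeps [N] positive when both vectors vanish. *)
pose N := `|u| + `|v| + 1.
have N0 : 0 < N by rewrite ltr_wpDl // addr_ge0.
pose h := del / N / 2.
have h0 : 0 < h by rewrite !divr_gt0.
have inb r s u' v' : `|u'| + `|v'| + 1 = N -> 0 <= r <= h -> 0 <= s <= h ->
    ball x del (x + r *: u' + s *: v').
  move=> EN /andP[r0 rh] /andP[s0 sh]; rewrite -ball_normE /ball_ /=.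
  rewrite -addrA opprD addrA subrr sub0r normrN.
  apply: (@le_lt_trans _ _ (h * N)).
    apply: (le_trans (ler_normD _ _)); rewrite !normrZ !ger0_norm // -EN.
    have A1 : r * `|u'| <= h * `|u'| by rewrite ler_wpM2r.
    have A2 : s * `|v'| <= h * `|v'| by rewrite ler_wpM2r.
    by rewrite !mulrDr mulr1; apply: (le_trans (lerD A1 A2)); rewrite lerDl ltW.
  by rewrite /h mulrAC divfK ?gt_eqF // gtr_pMr // invf_lt1 // ltr1n.
have [r [s [rh sh E1]]] := @second_difference _ U f x u v h oU sU h0
  (fun r s rh sh => let: And3 p _ _ := H _ (inb r s u v erefl rh sh) in p).
have EN : `|v| + `|u| + 1 = N by rewrite /N [`|v| + _]addrC.
have [r' [s' [rh' sh' E2]]] := @second_difference _ U f x v u h oU sU h0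
  (fun r s rh sh => let: And3 p _ _ := H _ (inb r s v u EN rh sh) in p).
have E : a (x + r *: u + s *: v) = b (x + r' *: v + s' *: u).
  have hh : h * h != 0 by rewrite mulf_neq0 // gt_eqF.
  apply: (mulfI hh); rewrite -E1 -E2 [x + h *: v + _]addrAC.
  by congr (_ + f x); rewrite [LHS]addrAC.
have [_ Ha _] := H _ (inb r s u v erefl rh sh).
have [_ _ Hb] := H _ (inb r' s' v u EN rh' sh').
move: Ha Hb; rewrite -!ball_normE /ball_ /= => Ha Hb.
rewrite -/(a x) -/(b x) -(subrKA (a (x + r *: u + s *: v))) {2}E.
rewrite (splitr eps); apply: (le_trans (ler_normD _ _)); apply: lerD; first exact: ltW.
by rewrite distrC ltW.
Qed.

(** Reduced to coordinates, because the mean value theorem is a statement about scalar functions. *)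
Lemma Schwarz V d (f : V -> 'rV[R]_d) (x u v : V) : smooth_at f x ->
  'd (fun y => 'd f y u) x v = 'd (fun y => 'd f y v) x u.
Proof.
move=> sf; apply/rowP => i.
pose p (w : 'rV[R]_d) : R := w ord0 i.
have pl : linear p by move=> a w z; rewrite /p !mxE.
pose L : {linear 'rV[R]_d -> R} := HB.pack p (GRing.isLinear.Build _ _ _ _ _ pl).
have cL : continuous L by exact: coord_continuous.
have dL (g : V -> 'rV[R]_d) y w : differentiable g y -> 'd (L \o g) y w = L ('d g y w).
  by move=> dg; have [_ ->] := diff_lincomp cL dg.
have key w z : ('d (fun y => 'd f y w) x z) ord0 i = 'd (fun y => 'd (L \o f) y w) x z.
  transitivity (L ('d (fun y => 'd f y w) x z)) => //.
  rewrite -dL; last by apply: smooth_at_diff; exact: smooth_at_d.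
  have sw : differentiable (L \o (fun y => 'd f y w)) x.
    by apply: smooth_at_diff; apply: smooth_at_lincomp => //; exact: smooth_at_d.
  have [|_ E] := @near_eq_diff _ _ _ _ (fun y => 'd (L \o f) y w) _ _ sw; last by rewrite E.
  by apply: filterS (smooth_at_near sf) => y sy /=; rewrite dL //; exact: smooth_at_diff.
by rewrite !key; apply: Schwarz_scalar; exact: smooth_at_lincomp.
Qed.

End MeanValue.

(** * Product rules for bilinear maps and for moving derivatives *)

Section ProductRule.
Variables (R : realType) (d : nat) (V W : normedModType R).
Local Notation E := 'rV[R]_d.

Lemma bilinear_rV_continuous (B : {bilinear E -> E -> W}) :
  continuous (fun p : E * E => B p.1 p.2).
Proof.
have -> : (fun p : E * E => B p.1 p.2) =
   (fun p : E * E => \sum_i \sum_j (p.1 ord0 i * p.2 ord0 j) *: B (delta_mx ord0 i) (delta_mx ord0 j)).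
  rewrite funeqE => -[u v] /=; rewrite {1}(row_sum_delta u) linear_sumlz.
  apply: eq_bigr => i _; rewrite {1}(row_sum_delta v) linear_sumr.
  by apply: eq_bigr => j _; rewrite linearZl_LR linearZr_LR /= scalerA.
move=> p; move: p; apply: sum_continuous => i; apply: sum_continuous => j p.
 apply: cvgZr_tmp; apply: cvgM.
  by apply: (continuous_comp (g := fun u : E => u ord0 i)); [exact: cvg_fst|exact: coord_continuous].
by apply: (continuous_comp (g := fun u : E => u ord0 j)); [exact: cvg_snd|exact: coord_continuous].
Qed.

Lemma diff_bilin_comp (B : {bilinear E -> E -> W}) (f h : V -> E) (x X : V) :
  differentiable f x -> differentiable h x ->
  differentiable (fun y => B (f y) (h y)) x /\
  'd (fun y => B (f y) (h y)) x X = B ('d f x X) (h x) + B (f x) ('d h x X).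
Proof.
move=> df dh; have bc := @bilinear_rV_continuous B.
have -> : (fun y => B (f y) (h y)) = (fun p : E * E => B p.1 p.2) \o (fun y => (f y, h y)) by [].
have dp := differentiable_pair df dh.
have db := differentiable_bilin (f x, h x) bc.
split; first exact: differentiable_comp.
rewrite [LHS](congr1 (fun h => h X) (diff_comp dp db)) /=.
rewrite [LHS](congr1 (fun h => h _) (diff_bilin (f x, h x) bc)) /=.
by rewrite (congr1 (fun h => h X) (diff_pair df dh)) /= addrC.
Qed.

(** Meant for maps whose bilinearity is a proved property rather than a structure: the Lie bracket
    and the invariant form. *)
Lemma diff_bilinear_comp (b : E -> E -> W) (f h : V -> E) (x X : V) :
  (forall a u v w, b (a *: u + v) w = a *: b u w + b v w) ->
  (forall a u v w, b w (a *: u + v) = a *: b w u + b w v) ->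
  differentiable f x -> differentiable h x ->
  differentiable (fun y => b (f y) (h y)) x /\
  'd (fun y => b (f y) (h y)) x X = b ('d f x X) (h x) + b (f x) ('d h x X).
Proof.
move=> bl br df dh.
have bb : bilinear_for
    (GRing.Scale.Law.clone _ _ *:%R _) (GRing.Scale.Law.clone _ _ *:%R _) b.
  by split=> [w a u v|w a u v] /=.
pose B : {bilinear E -> E -> W} :=
  HB.pack b (bilinear_isBilinear.Build R E E W _ _ b bb).
exact: (@diff_bilin_comp B).
Qed.

End ProductRule.

(** Two contributions: the base point moves while the vector is frozen, and the vector moves while
    the base point is frozen. Expanding the vector in a finite basis reduces this to the rule for a
    scalar times a vector. *)
Lemma diff_diff_comp (R : realType) (V W W' : normedModType R) (h : W -> W') (k : V -> W)
    (f : V -> W) (x X : V) : fin_basis W ->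
  smooth_at h (k x) -> smooth_at k x -> differentiable f x ->
  'd (fun y => 'd h (k y) (f y)) x X =
  'd (fun y => 'd h (k y) (f x)) x X + 'd h (k x) ('d f x X).
Proof.
move=> bW sh sk df; have [n [b [l [lc lb]]]] := bW.
have dhk v : differentiable (fun y => 'd h (k y) v) x.
  apply: smooth_at_diff; apply: (@smooth_at_comp _ _ _ _ k (fun y => 'd h y v)) => //.
  exact: smooth_at_d.
have dl i := diff_lincomp (lc i) df.
have ds i := diff_scale (dl i).1 (dhk (b i)).
have dsum (m : nat) (F : 'I_m -> V -> W') : (forall i, differentiable (F i) x) ->
    differentiable (fun y => \sum_i F i y) x /\
    'd (fun y => \sum_i F i y) x X = \sum_i 'd (F i) x X.
  elim: m F => [|m IH] F dF.
    rewrite (_ : (fun y => _) = cst 0); last first.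
      by rewrite funeqE => y; rewrite big_ord0.
    by rewrite big_ord0 diff_cst; split => //; exact: differentiable_cst.
  rewrite (_ : (fun y => _) = F ord0 + (fun y => \sum_i F (lift ord0 i) y)); last first.
    by rewrite funeqE => y; rewrite big_ord_recl.
  have [d1 e1] := IH (fun i => F (lift ord0 i)) (fun i => dF _).
  split; first exact: differentiableD.
  by rewrite [LHS](congr1 (fun h => h X) (diffD (dF ord0) d1)) big_ord_recl -e1.
have e1 : (fun y => 'd h (k y) (f y)) =
    (fun y => \sum_i l i (f y) *: 'd h (k y) (b i)).
  rewrite funeqE => y; rewrite {1}(lb (f y)) linear_sum.
  by apply: eq_bigr => i _; rewrite linearZ.
have e2 : (fun y => 'd h (k y) (f x)) =
    (fun y => \sum_i l i (f x) *: 'd h (k y) (b i)).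
  rewrite funeqE => y; rewrite {1}(lb (f x)) linear_sum.
  by apply: eq_bigr => i _; rewrite linearZ.
rewrite e1 (dsum _ _ (fun i => (ds i).1)).2 e2.
rewrite (dsum _ _ (fun i => differentiableZ (l i (f x)) (dhk (b i)))).2.
rewrite [in RHS](lb ('d f x X)) linear_sum -big_split /=; apply: eq_bigr => i _.
rewrite linearZ; apply: etrans ((ds i).2 X) _; rewrite (dl i).2.
by congr (_ + _); exact/esym/(congr1 (fun h => h X) (diffZ _ (dhk (b i)))).
Qed.

(** * The adjoint representation and the Lie bracket *)

Section Adjoint.
Variables (R : realType) (d : nat) (G : groupTopologicalType).
Variables (atlas : set (chart R d G)) (HG : lie_group atlas).
Variables (c : chart R d G).
Hypotheses (sc : smooth_chart atlas c) (c1 : chart_dom c 1%g).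
Local Notation E := 'rV[R]_d.
Local Notation e := (chart_fun c 1%g).
Local Notation psi := (chart_inv c).
Local Notation br := (lie_bracket c).

Definition conj_chart (g : G) (x : E) := chart_fun c (g * psi x * g^-1)%g.

Lemma chart_inv1 : psi e = 1%g.
Proof. by rewrite chart_funK. Qed.

Lemma chart_img1 : chart_img c e.
Proof. by exists 1%g. Qed.

Lemma chart_invK x : chart_img c x -> chart_fun c (psi x) = x.
Proof. by move=> [g cg <-]; rewrite chart_funK. Qed.

Lemma near_chart_img : \forall x \near e, chart_img c x.
Proof.
exact: (open_nbhs_nbhs (conj (@chart_img_open _ _ _ c) chart_img1)).
Qed.

Lemma near_chart_dom (T : topologicalType) (F : T -> G) t :
  {for t, continuous F} -> F t = 1%g -> \forall x \near t, chart_dom c (F x).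
Proof.
move=> Fc F1; apply: (Fc (chart_dom c)).
by apply: open_nbhs_nbhs; split; [exact: chart_dom_open|rewrite F1].
Qed.

Lemma Gsmooth_psi : Gsmooth atlas psi e.
Proof. exact: (Gsmooth_chart_inv HG sc chart_img1). Qed.

Lemma Gsmooth_conj g : Gsmooth atlas (fun x => g * psi x * g^-1)%g e.
Proof.
apply: (Gsmooth_mul HG); last exact: Gsmooth_cst.
by apply: (Gsmooth_mul HG); [exact: Gsmooth_cst|exact: Gsmooth_psi].
Qed.

Lemma conj_psi1 g : (g * psi e * g^-1)%g = 1%g.
Proof. by rewrite chart_inv1 mulg1 mulgV. Qed.

Lemma conj_chart1 g : conj_chart g e = e.
Proof. by rewrite /conj_chart conj_psi1. Qed.

Lemma conj_smooth g : smooth_at (conj_chart g) e.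
Proof.
by apply: (Gsmooth_chart sc _ (Gsmooth_conj g)); rewrite conj_psi1.
Qed.

Lemma near_conj_dom g : \forall x \near e, chart_dom c (g * psi x * g^-1)%g.
Proof.
by apply: near_chart_dom; [have [] := Gsmooth_conj g|rewrite conj_psi1].
Qed.

Lemma AdE g v : Ad c g v = 'd (conj_chart g) e v.
Proof. by []. Qed.

Lemma AdP g a u v : Ad c g (a *: u + v) = a *: Ad c g u + Ad c g v.
Proof. by rewrite !AdE linearP. Qed.

Lemma Ad_cont g : continuous (Ad c g).
Proof. exact: (diff_continuous (smooth_at_diff (conj_smooth g))). Qed.

Lemma Ad1 v : Ad c 1%g v = v.
Proof.
rewrite AdE (@near_diffE _ _ _ (fun x => x)) ?diff_idE //.
  apply: filterS near_chart_img => x ix.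
  by rewrite /conj_chart mul1g invg1 mulg1 chart_invK.
Qed.

Lemma AdM g h v : Ad c (g * h)%g v = Ad c g (Ad c h v).
Proof.
have dh := smooth_at_diff (conj_smooth h).
have dg : differentiable (conj_chart g) (conj_chart h e).
  by rewrite conj_chart1; exact: smooth_at_diff (conj_smooth g).
have dgh := differentiable_comp dh dg.
rewrite AdE (near_diffE _ _ dgh).
  by rewrite (diff_compE v dh dg) conj_chart1.
apply: filterS (near_conj_dom h) => x hx /=.
by rewrite /conj_chart chart_funK // invgM !mulgA.
Qed.

Lemma smooth_at_pairl (x y : E) : smooth_at (fun z : E => (z, y)) x.
Proof. by apply: smooth_at_pair; [exact: smooth_at_id|exact: smooth_at_cst]. Qed.

Lemma smooth_at_pairr (x y : E) : smooth_at (fun z : E => (x, z)) y.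
Proof. by apply: smooth_at_pair; [exact: smooth_at_cst|exact: smooth_at_id]. Qed.

Lemma diff_pairl (x y v : E) : 'd (fun z : E => (z, y)) x v = (v, 0).
Proof.
have dF := smooth_at_diff (smooth_at_pairl x y).
have [_ E1] := @diff_lincomp _ _ _ _ _ (fst : {linear (E * E)%type -> E}) _ (fun p => @cvg_fst _ _ _ _ _) dF.
have [_ E2] := @diff_lincomp _ _ _ _ _ (snd : {linear (E * E)%type -> E}) _ (fun p => @cvg_snd _ _ _ _ _) dF.
rewrite [LHS]surjective_pairing -(E1 v) -(E2 v).
by congr pair; [exact: diff_idE|exact: diff_constE].
Qed.

Lemma diff_pairr (x y v : E) : 'd (fun z : E => (x, z)) y v = (0, v).
Proof.
have dF := smooth_at_diff (smooth_at_pairr x y).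
have [_ E1] := @diff_lincomp _ _ _ _ _ (fst : {linear (E * E)%type -> E}) _ (fun p => @cvg_fst _ _ _ _ _) dF.
have [_ E2] := @diff_lincomp _ _ _ _ _ (snd : {linear (E * E)%type -> E}) _ (fun p => @cvg_snd _ _ _ _ _) dF.
rewrite [LHS]surjective_pairing -(E1 v) -(E2 v).
by congr pair; [exact: diff_constE|exact: diff_idE].
Qed.

Definition mul_chart (p : E * E) := chart_fun c (psi p.1 * psi p.2)%g.
Definition conj2_chart (p : E * E) := chart_fun c (psi p.1 * psi p.2 * (psi p.1)^-1)%g.

Lemma fin_basis_EE : fin_basis (E * E)%type.
Proof. by apply: fin_basis_prod; exact: fin_basis_rV. Qed.

Lemma Gsmooth_fst : Gsmooth atlas (fun p : E * E => psi p.1) (e, e).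
Proof.
apply: (Gsmooth_comp (fin_basis_rV R d) (f := fst)); last exact: Gsmooth_psi.
exact: (smooth_at_fst (smooth_at_id _)).
Qed.

Lemma Gsmooth_snd : Gsmooth atlas (fun p : E * E => psi p.2) (e, e).
Proof.
apply: (Gsmooth_comp (fin_basis_rV R d) (f := snd)); last exact: Gsmooth_psi.
exact: (smooth_at_snd (smooth_at_id _)).
Qed.

Lemma Gsmooth_mul2 : Gsmooth atlas (fun p : E * E => psi p.1 * psi p.2)%g (e, e).
Proof. exact: (Gsmooth_mul HG Gsmooth_fst Gsmooth_snd). Qed.

Lemma Gsmooth_conj2 :
  Gsmooth atlas (fun p : E * E => psi p.1 * psi p.2 * (psi p.1)^-1)%g (e, e).
Proof.
exact: (Gsmooth_mul HG Gsmooth_mul2 (Gsmooth_inv HG Gsmooth_fst)).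
Qed.

Lemma mul_smooth : smooth_at mul_chart (e, e).
Proof.
by apply: (Gsmooth_chart sc _ Gsmooth_mul2); rewrite /= chart_inv1 mulg1.
Qed.

Lemma conj2_smooth : smooth_at conj2_chart (e, e).
Proof.
by apply: (Gsmooth_chart sc _ Gsmooth_conj2); rewrite /= conj_psi1.
Qed.

Lemma near_pairl (P : E * E -> Prop) (x y : E) :
  (\forall p \near (x, y), P p) -> nbhs x (fun z : E => P (z, y)).
Proof. exact: (smooth_at_cont (smooth_at_pairl x y)). Qed.

Lemma near_pairr (P : E * E -> Prop) (x y : E) :
  (\forall p \near (x, y), P p) -> nbhs y (fun z : E => P (x, z)).
Proof. exact: (smooth_at_cont (smooth_at_pairr x y)). Qed.

(** The adjoint action of [psi x] is the partial derivative in y, at (x, e), of the jointly smooth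
    map x y x^-1. This is what makes it smooth in [x]. *)
Lemma near_Ad Y :
  \forall x \near e, Ad c (psi x) Y = 'd conj2_chart (x, e) (0, Y).
Proof.
apply: filterS (near_pairl (smooth_at_near conj2_smooth)) => x sx.
have dx := smooth_at_diff (smooth_at_pairr x e).
rewrite AdE -(diff_pairr x e Y).
exact: (diff_compE Y dx (smooth_at_diff sx)).
Qed.

Lemma Ad_smooth Y : smooth_at (fun x => Ad c (psi x) Y) e.
Proof.
apply: (@smooth_at_near_eq _ _ _ (fun x => 'd conj2_chart (x, e) (0, Y))).
  by apply: filterS (near_Ad Y) => x ->.
apply: (@smooth_at_comp _ _ _ _ (fun z : E => (z, e)) (fun p => 'd conj2_chart p (0, Y))).
- exact: fin_basis_EE.
- exact: smooth_at_pairl.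
- exact/smooth_at_d/conj2_smooth.
Qed.

Lemma Ad_diff Y : differentiable (fun x => Ad c (psi x) Y) e.
Proof. exact: smooth_at_diff (Ad_smooth Y). Qed.

Lemma bracketPl a X Y Z : br (a *: X + Y) Z = a *: br X Z + br Y Z.
Proof. by rewrite /lie_bracket linearP. Qed.

Lemma bracketPr a X Y Z : br Z (a *: X + Y) = a *: br Z X + br Z Y.
Proof.
rewrite /lie_bracket.
have -> : (fun x => Ad c (psi x) (a *: X + Y)) =
  (a *: (fun x => Ad c (psi x) X)) + (fun x => Ad c (psi x) Y).
  by rewrite funeqE => x; rewrite AdP.
have dX := differentiableZ a (Ad_diff X).
rewrite [LHS](congr1 (fun h => h Z) (diffD dX (Ad_diff Y))).
by congr (_ + _); exact: (congr1 (fun h => h Z) (diffZ a (Ad_diff X))).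
Qed.

(** Derivative at 1 in direction [X] of Ad(g) Ad(x) Y = Ad(g x g^-1) Ad(g) Y. *)
Lemma Ad_bracket g X Y : Ad c g (br X Y) = br (Ad c g X) (Ad c g Y).
Proof.
have [_ E1] := diff_lincomp (@Ad_cont g) (Ad_diff Y).
rewrite [LHS](esym (E1 X)).
have dg := smooth_at_diff (conj_smooth g).
have df : differentiable (fun x => Ad c (psi x) (Ad c g Y)) (conj_chart g e).
  by rewrite conj_chart1; exact: Ad_diff.
have dc := differentiable_comp dg df.
rewrite (near_diffE _ _ dc).
  apply: etrans (diff_compE X dg df) _.
  rewrite conj_chart1.
  rewrite /lie_bracket.
  reflexivity.
apply: filterS (near_conj_dom g) => x gx /=.
rewrite /conj_chart chart_funK; last exact: gx.
apply: etrans (esym (AdM _ g Y)) _.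
by rewrite -mulgA mulVg mulg1; exact: AdM.
Qed.

(** Derivative at 1 in direction [X] of Ad(x) [Y, Z] = [Ad(x) Y, Ad(x) Z]. *)
Lemma bracket_leibniz X Y Z : br X (br Y Z) = br (br X Y) Z + br Y (br X Z).
Proof.
have [_ E1] := diff_bilinear_comp X bracketPl (fun a u v w => bracketPr a u v w) (Ad_diff Y) (Ad_diff Z).
rewrite {1}/lie_bracket.
have -> : (fun x => Ad c (psi x) (br Y Z)) =
    (fun x => br (Ad c (psi x) Y) (Ad c (psi x) Z)).
  by rewrite funeqE => x; exact: Ad_bracket.
by rewrite E1 chart_inv1 !Ad1.
Qed.

(** Derivative at 1 in direction [X] of the constant function b(Ad(x) u, Ad(x) v). *)
Lemma form_invariant (b : E -> E -> R) X u v :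
  (forall a u v w, b (a *: u + v) w = a * b u w + b v w) ->
  (forall a u v w, b w (a *: u + v) = a * b w u + b w v) ->
  (forall g u v, b (Ad c g u) (Ad c g v) = b u v) ->
  b (br X u) v = - b u (br X v).
Proof.
move=> bl brr bG.
have [_ E1] := diff_bilinear_comp X bl brr (Ad_diff u) (Ad_diff v).
apply/eqP; rewrite -addr_eq0; apply/eqP.
rewrite chart_inv1 !Ad1 in E1; rewrite -[LHS]E1.
have -> : (fun x => b (Ad c (psi x) u) (Ad c (psi x) v)) = cst (b u v).
  by rewrite funeqE => x; exact: bG.
by rewrite diff_cst.
Qed.

(** For fixed x, this is (x y x^-1) x = x y differentiated at y = e in direction [B]. *)
Lemma near_mul_conj2 B :
  \forall x \near e, 'd mul_chart (e, x) (Ad c (psi x) B, 0) =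
                     'd mul_chart (x, e) (0, B).
Proof.
have : \forall p \near (e, e), chart_dom c (psi p.1 * psi p.2 * (psi p.1)^-1)%g.
  by apply: near_chart_dom; [have [] := Gsmooth_conj2|rewrite /= conj_psi1].
(* A neighbourhood of (e, e) contains a product: [A1] restricts x, while [A2] leaves room to
   differentiate in y. *)
move=> [[A1 A2] /= [nA1 nA2] A12].
have n1 := near_pairl (smooth_at_near mul_smooth).
have n2 := near_pairr (smooth_at_near mul_smooth).
apply: filterS3 nA1 n1 n2 => x A1x s1 s2.
have dc := smooth_at_diff (conj_smooth (psi x)).
have dp := smooth_at_diff (smooth_at_pairl (conj_chart (psi x) e) x).
have dpc := differentiable_comp dc dp.
have dm : differentiable mul_chart (conj_chart (psi x) e, x).
  by rewrite conj_chart1; exact: smooth_at_diff.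
have dmpc := differentiable_comp dpc dm.
have dx := smooth_at_diff (smooth_at_pairr x e).
have E1 : 'd (mul_chart \o pair x) e B = 'd mul_chart (x, e) (0, B).
  exact: etrans (diff_compE B dx (smooth_at_diff s1))
    (congr1 ('d mul_chart (x, e)) (diff_pairr x e B)).
have v2 : 'd ((fun z : E => (z, x)) \o conj_chart (psi x)) e B = (Ad c (psi x) B, 0).
  exact: etrans (diff_compE B dc dp) (diff_pairl _ _ _).
have p2 : ((fun z : E => (z, x)) \o conj_chart (psi x)) e = (e, x).
  by rewrite /= conj_chart1.
have E2 : 'd (mul_chart \o ((fun z : E => (z, x)) \o conj_chart (psi x))) e B =
    'd mul_chart (e, x) (Ad c (psi x) B, 0).
  apply: etrans (diff_compE B dpc dm) _.
  by apply: etrans (congr1 _ v2) _; rewrite p2.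
apply: etrans (esym E2) (etrans _ E1).
apply/esym; apply: near_diffE dmpc.
apply: filterS nA2 => y A2y /=.
by rewrite /mul_chart /conj_chart /= chart_funK ?mulgVK //; exact: (A12 (x, y)).
Qed.

Lemma diff_mul_chartl v : 'd mul_chart (e, e) (v, 0) = v.
Proof.
have dx := smooth_at_diff (smooth_at_pairl e e).
have dm := smooth_at_diff mul_smooth.
have E1 := diff_compE v dx dm; rewrite diff_pairl in E1; rewrite -[LHS]E1.
rewrite (@near_diffE _ _ _ (fun x => x)) ?diff_idE //.
by apply: filterS near_chart_img => x ix; rewrite /mul_chart /= chart_inv1 mulg1 chart_invK.
Qed.

(* Differentiate mul_chart (conj2_chart (x, y), x) = mul_chart (x, y) first in
   y and then in x: the bracket is the antisymmetric part of the mixed second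
   derivative of the multiplication. *)
Lemma bracket_second_diff X Y :
  br X Y = 'd (fun p => 'd mul_chart p (0, Y)) (e, e) (X, 0) -
           'd (fun p => 'd mul_chart p (Y, 0)) (e, e) (0, X).
Proof.
have dl := smooth_at_diff (smooth_at_pairl e e).
have dr := smooth_at_diff (smooth_at_pairr e e).
have dD u : differentiable (fun p => 'd mul_chart p u) (e, e).
  by apply/smooth_at_diff/smooth_at_d/mul_smooth.
have E1 : 'd ((fun p => 'd mul_chart p (0, Y)) \o (fun x : E => (x, e))) e X =
    'd (fun p => 'd mul_chart p (0, Y)) (e, e) (X, 0).
  exact: etrans (diff_compE X dl (dD _)) (congr1 _ (diff_pairl e e X)).
have dA : differentiable (fun x => (Ad c (psi x) Y, 0 : E)) e.
  by apply: differentiable_pair; [exact: Ad_diff|exact: differentiable_cst].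
have E2 : 'd (fun y => 'd mul_chart (e, y) (Ad c (psi e) Y, 0)) e X =
    'd (fun p => 'd mul_chart p (Y, 0)) (e, e) (0, X).
  rewrite chart_inv1 Ad1.
  exact: etrans (diff_compE X dr (dD (Y, 0))) (congr1 _ (diff_pairr e e X)).
have E3 : 'd (fun x => (Ad c (psi x) Y, 0 : E)) e X = (br X Y, 0).
  exact: etrans (diff_compE X (Ad_diff Y) (smooth_at_diff (smooth_at_pairl _ _)))
    (diff_pairl _ _ _).
(* Base point and vector both move with x; the moving vector Ad(x) Y is what contributes the
   bracket. *)
have E4 := diff_diff_comp X fin_basis_EE mul_smooth (smooth_at_pairr e e) dA.
have E5 := etrans E4 (f_equal2 +%R E2 (etrans (congr1 _ E3) (diff_mul_chartl _))).
have E6 : 'd ((fun p => 'd mul_chart p (0, Y)) \o (fun x : E => (x, e))) e X =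
    'd (fun y => 'd mul_chart (e, y) (Ad c (psi y) Y, 0)) e X.
  apply/esym; apply: near_diffE; last exact: differentiable_comp dl (dD (0, Y)).
  by apply: filterS (near_mul_conj2 Y) => x Hx; exact: esym Hx.
have aux (u v w : E) : u + v = w -> v = w - u by move=> <-; rewrite addrC addKr.
exact: aux (etrans (esym E5) (etrans (esym E6) E1)).
Qed.

(** Exchanging [X] and [Y] in [bracket_second_diff] turns each of its two terms into the other with
    the order of differentiation reversed. *)
Lemma bracket_anti X Y : br X Y = - br Y X.
Proof.
apply: etrans (bracket_second_diff X Y) _.
apply: etrans (esym (congr1 -%R (bracket_second_diff Y X))); rewrite opprB.
exact: f_equal2 (Schwarz (0, Y) (X, 0) mul_smooth) (congr1 -%R (Schwarz (Y, 0) (0, X) mul_smooth)).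
Qed.

End Adjoint.

(** * An invariant inner product *)

Section Frobenius.
Variable R : realType.

Definition frob m n (A : 'M[R]_(m, n)) : R := \sum_i \sum_j A i j ^+ 2.

Lemma frob_ge0 m n (A : 'M[R]_(m, n)) : 0 <= frob A.
Proof. by apply: sumr_ge0 => i _; apply: sumr_ge0 => j _; exact: sqr_ge0. Qed.

Lemma frob_entry m n (A : 'M[R]_(m, n)) i j : A i j ^+ 2 <= frob A.
Proof.
rewrite /frob (bigD1 i) //= (bigD1 j) //= -addrA lerDl addr_ge0 //.
  by apply: sumr_ge0 => k _; exact: sqr_ge0.
by apply: sumr_ge0 => k _; apply: sumr_ge0 => l _; exact: sqr_ge0.
Qed.

Lemma frob_eq0 m n (A : 'M[R]_(m, n)) : frob A <= 0 -> A = 0.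
Proof.
move=> A0; apply/matrixP => i j; rewrite mxE; apply/eqP.
by rewrite -sqrf_eq0 eq_le sqr_ge0 andbT (le_trans (frob_entry A i j)).
Qed.

Lemma frob_tr m n (A : 'M[R]_(m, n)) : frob A^T = frob A.
Proof.
rewrite /frob exchange_big /=; apply: eq_bigr => i _; apply: eq_bigr => j _.
by rewrite mxE.
Qed.

(** Lagrange's identity: the double sum of (a_i b_j - a_j b_i)^2 is twice the difference of the two
    sides. *)
Lemma cauchy_schwarz_sum n (a b : 'I_n -> R) :
  (\sum_i a i * b i) ^+ 2 <= (\sum_i a i ^+ 2) * (\sum_i b i ^+ 2).
Proof.
have H : 0 <= \sum_i \sum_j (a i * b j - a j * b i) ^+ 2.
  by apply: sumr_ge0 => i _; apply: sumr_ge0 => j _; exact: sqr_ge0.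
have E1 : \sum_i \sum_j (a i ^+ 2 * b j ^+ 2) = (\sum_i a i ^+ 2) * (\sum_i b i ^+ 2).
  rewrite mulr_suml; apply: eq_bigr => i _; by rewrite mulr_sumr.
have E2 : \sum_i \sum_j (a i * b i) * (a j * b j) = (\sum_i a i * b i) ^+ 2.
  rewrite expr2 mulr_suml; apply: eq_bigr => i _; by rewrite mulr_sumr.
have E3 : \sum_i \sum_j (a j ^+ 2 * b i ^+ 2) = (\sum_i a i ^+ 2) * (\sum_i b i ^+ 2).
  by rewrite exchange_big.
have : \sum_i \sum_j (a i * b j - a j * b i) ^+ 2 =
   (\sum_i a i ^+ 2) * (\sum_i b i ^+ 2) + (\sum_i a i ^+ 2) * (\sum_i b i ^+ 2)
   - ((\sum_i a i * b i) ^+ 2 + (\sum_i a i * b i) ^+ 2).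
  rewrite -{1}E1 -{1}E3 -E2 -!big_split -sumrB /=; apply: eq_bigr => i _.
  rewrite -!big_split -sumrB /=; apply: eq_bigr => j _; ring.
by move: H => /[swap] ->; lra.
Qed.

Lemma frob_mul m n p (A : 'M[R]_(m, n)) (B : 'M[R]_(n, p)) :
  frob (A *m B) <= frob A * frob B.
Proof.
rewrite /frob mulr_suml; apply: ler_sum => i _.
rewrite [X in _ * X]exchange_big /= mulr_sumr; apply: ler_sum => j _.
by rewrite mxE; exact: cauchy_schwarz_sum.
Qed.

(** The last term is the strict convexity that will force a minimizer to be invariant. *)
Lemma frob_parallelogram m n (A B : 'M[R]_(m, n)) :
  frob (2^-1 *: (A + B)) = 2^-1 * frob A + 2^-1 * frob B - 4^-1 * frob (A - B).
Proof.
rewrite /frob !mulr_sumr -big_split -sumrB /=; apply: eq_bigr => i _.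
rewrite !mulr_sumr -big_split -sumrB /=; apply: eq_bigr => j _.
by rewrite !mxE; field.
Qed.

Lemma frob_rV n (u : 'rV[R]_n) : frob u = (u *m u^T) ord0 ord0.
Proof.
rewrite /frob big_ord1 mxE; apply: eq_bigr => j _; by rewrite mxE expr2.
Qed.

Lemma linear_rV_continuous n (f : 'rV[R]_n -> R) : linear f -> continuous f.
Proof.
move=> fl.
pose L : {linear 'rV[R]_n -> R} := HB.pack f (GRing.isLinear.Build _ _ _ _ _ fl).
have -> : f = fun v : 'rV[R]_n => \sum_i v ord0 i * f (delta_mx ord0 i).
  rewrite funeqE => v; rewrite {1}(row_sum_delta v) -[LHS]/(L _) linear_sum.
  by apply: eq_bigr => i _; rewrite linearZ.
apply: sum_continuous => i v.
apply: (@continuousM _ _ (fun v : 'rV[R]_n => v ord0 i) (fun=> f (delta_mx ord0 i)) v).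
  exact: coord_continuous.
exact: cst_continuous.
Qed.

End Frobenius.

(** * An invariant positive form for a bounded group of matrices *)

Section InvariantForm.
Variables (R : realType) (d : nat) (T : Type) (M : T -> 'M[R]_d) (C : R).
Hypothesis Mmul : forall g h, exists k, M k = M g *m M h.
Hypothesis Mone : exists g, M g = 1%:M.
Hypothesis Minv : forall g, exists h, M g *m M h = 1%:M.
Hypothesis Mbnd : forall g, frob (M g) <= C.

Let act g (S : 'M[R]_d) := M g *m S *m (M g)^T.

Let C_ge0 : 0 <= C.
Proof. by have [g _] := Mone; exact: le_trans (frob_ge0 _) (Mbnd g). Qed.

Let act_linear g : linear (act g).
Proof. by move=> a S S'; rewrite /act mulmxDr mulmxDl -scalemxAr -scalemxAl. Qed.

Let actB g S S' : act g (S - S') = act g S - act g S'.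
Proof. by rewrite /act mulmxBr mulmxBl. Qed.

Let act_mid g S S' : act g (2^-1 *: (S + S')) = 2^-1 *: (act g S + act g S').
Proof. by rewrite /act -mulmxDl -mulmxDr -scalemxAr -scalemxAl. Qed.

Let act_act g h : exists k, forall S, act g (act h S) = act k S.
Proof.
have [k kE] := Mmul g h; exists k => S.
by rewrite /act kE trmx_mul !mulmxA.
Qed.

Let frob_act g S : frob (act g S) <= C * C * frob S.
Proof.
rewrite /act; apply: (le_trans (frob_mul _ _)); rewrite frob_tr.
rewrite mulrAC; apply: ler_pM => //; try exact: frob_ge0.
by apply: (le_trans (frob_mul _ _)); apply: ler_wpM2r => //; exact: frob_ge0.
Qed.

(** The summand 1 keeps the constant invertible when [C = 0]; likewise for [K1]. *)
Let K2 := C * C + 1.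
Let K2_gt0 : 0 < K2.
Proof. by rewrite /K2 ltr_wpDl // mulr_ge0. Qed.

Let frob_act_ge g S : K2^-1 * frob S <= frob (act g S).
Proof.
have [h gh] := Minv g.
have hg := mulmx1C gh.
have ES : act h (act g S) = S.
  by rewrite /act !mulmxA hg mul1mx -mulmxA -trmx_mul hg trmx1 mulmx1.
rewrite ler_pdivrMl // -{1}ES; apply: (le_trans (frob_act _ _)).
by apply: ler_wpM2r; [exact: frob_ge0|rewrite lerDl].
Qed.

Let K1 := C + 1.
Let K1_gt0 : 0 < K1.
Proof. by rewrite /K1 ltr_wpDl. Qed.

(** A lower bound uniform over the orbit is a closed condition, unlike strict positivity, and still
    forces positive definiteness. The constant [K1^-1] is one that the identity matrix satisfies. *)
Let admissible (S : 'M[R]_d) := S^T = S /\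
  forall g (u : 'rV[R]_d), K1^-1 * frob u <= (u *m act g S *m u^T) ord0 ord0.

Let bounded_by (t : R) (S : 'M[R]_d) := forall g, frob (act g S) <= t.

Let admissible1 : admissible 1%:M.
Proof.
split=> [|g u]; first by rewrite trmx1.
have [h gh] := Minv g.
rewrite /act mulmx1 mulmxA -mulmxA -trmx_mul -frob_rV.
rewrite ler_pdivrMl // -{1}(mulmx1 u) -gh mulmxA.
apply: (le_trans (frob_mul _ _)); rewrite mulrC; apply: ler_wpM2r; first exact: frob_ge0.
by apply: (le_trans (Mbnd h)); rewrite lerDl.
Qed.

(** The infimum [m] of these bounds is the minimal value of the invariant convex function sup_g frob
    (act g S). *)
Let bounds := [set t | exists2 S, admissible S & bounded_by t S].

Let has_inf_bounds : has_inf bounds.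
Proof.
split.
  exists (C * C * frob (1%:M : 'M[R]_d)), 1%:M => // g; exact: frob_act.
exists 0 => t [S _ St]; have [g _] := Mone.
exact: le_trans (frob_ge0 _) (St g).
Qed.

Let m := inf bounds.

(** Each condition is closed for a fixed index, and the set is the intersection over all of them.
    Matrices are vectorized so that Heine-Borel can be applied to row vectors. *)
Let closed_admissible_bounded t :
  closed [set v : 'rV[R]_(d * d) | admissible (vec_mx v) /\ bounded_by t (vec_mx v)].
Proof.
have lin (f : 'rV[R]_(d * d) -> R) : linear f -> continuous f.
  exact: linear_rV_continuous.
have ->: [set v : 'rV[R]_(d * d) | admissible (vec_mx v) /\ bounded_by t (vec_mx v)] =
  (\bigcap_(ij in [set: 'I_d * 'I_d]) [set v : 'rV[R]_(d * d) | vec_mx v ij.1 ij.2 - vec_mx v ij.2 ij.1 = 0]) `&`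
  ((\bigcap_(gu in [set: T * 'rV[R]_d]) [set v : 'rV[R]_(d * d) |
     K1^-1 * frob gu.2 <= (gu.2 *m act gu.1 (vec_mx v) *m gu.2^T) ord0 ord0]) `&`
   \bigcap_(g in [set: T]) [set v : 'rV[R]_(d * d) | frob (act g (vec_mx v)) <= t]).
  rewrite eqEsubset; split=> v /=.
    move=> [[sv av] bv]; split=> [[i j] _ /=|]; first by move/matrixP: sv => /(_ j i); rewrite mxE => ->; exact: subrr.
    by split=> [[g u] _ /=|g _ /=]; [exact: av|exact: bv].
  move=> [sv [av bv]]; split; last by move=> g; exact: bv.
  split=> [|g u]; last exact: (av (g, u)).
  by apply/matrixP => i j; rewrite mxE; apply/subr0_eq; exact: (sv (j, i)).
apply: closedI; last apply: closedI.
- apply: closed_bigI => -[i j] _ /=.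
  apply: (@closed_comp _ _ (fun v : 'rV[R]_(d*d) => vec_mx v i j - vec_mx v j i) [set 0]); last exact: closed_eq.
  by move=> v _; apply: lin => a u w; rewrite linearP !mxE /GRing.scale /=; ring.
- apply: closed_bigI => -[g u] _ /=.
  apply: (@closed_comp _ _ (fun v : 'rV[R]_(d*d) => (u *m act g (vec_mx v) *m u^T) ord0 ord0) [set x | K1^-1 * frob u <= x]); last exact: closed_ge.
  move=> v _; apply: lin => a w w'.
  by rewrite linearP act_linear mulmxDr mulmxDl -scalemxAr -scalemxAl !mxE.
- apply: closed_bigI => g _ /=.
  apply: (@closed_comp _ _ (fun v : 'rV[R]_(d*d) => frob (act g (vec_mx v))) [set x | x <= t]); last exact: closed_le.
  move=> v _; move: v; apply: sum_continuous => i; apply: sum_continuous => j v.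
  have : continuous (fun v : 'rV[R]_(d*d) => act g (vec_mx v) i j).
    by apply: lin => a w w'; rewrite linearP act_linear !mxE.
  by move=> ca; exact: (@continuousM _ _ _ _ v (ca v) (ca v)).
Qed.

(** The sets [L e] are nonempty, closed and shrink with [e], and [L 1] is compact; a cluster point
    of the filter that they generate lies in all of them. *)
Let minimizer : exists S, admissible S /\ forall g, frob (act g S) <= m.
Proof.
pose L (e : R) := [set v : 'rV[R]_(d * d) | admissible (vec_mx v) /\ bounded_by (m + e) (vec_mx v)].
have L0 e : 0 < e -> exists v, L e v.
  move=> e0; have [t [S Sa St] tm] := inf_adherent e0 has_inf_bounds.
  exists (mxvec S); rewrite /L /= mxvecK; split=> // g.
  exact: le_trans (St g) (ltW tm).
have Lle e e' v : e <= e' -> L e v -> L e' v.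
  move=> ee' [va vb]; split=> // g; apply: (le_trans (vb g)); by rewrite lerD2l.
have cL : compact (L 1).
  apply: bounded_closed_compact; last exact: closed_admissible_bounded.
  have [g g1] := Mone.
  (* Each entry x satisfies x^2 <= m + 1, and |x| <= x^2 + 1. *)
  exists (m + 1 + 1); split; first exact: num_real.
  move=> b mb v [_ /(_ g)]; rewrite /act g1 mul1mx trmx1 mulmx1 => vb.
  rewrite /= /Num.Def.normr /= mx_normrE; apply: bigmax_le.
    apply: le_trans (ltW mb); have := le_trans (frob_ge0 _) vb; lra.
  move=> [i k] _ /=; rewrite ord1.
  case/mxvec_indexP: k => k l.
  rewrite -{1}(vec_mxK v) mxvecE.
  have := le_trans (frob_entry (vec_mx v) k l) vb.
  have : `|vec_mx v k l| ^+ 2 = vec_mx v k l ^+ 2 by rewrite real_normK ?num_real.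
  have := normr_ge0 (vec_mx v k l).
  nra.
pose F := filter_from [set e : R | 0 < e] L.
have PF : ProperFilter F.
  apply: filter_from_proper; last by move=> e e0; have [v Lv] := L0 e e0; exists v.
  apply: filter_from_filter; first by exists 1 => /=.
  move=> e e' /= e0 e'0; exists (Num.min e e'); first by rewrite /= lt_min e0.
  by move=> v Lv; split; apply: Lle Lv; rewrite ge_min lexx ?orbT.
have F1 : F (L 1) by exists 1 => /=.
have [v [L1v clv]] := cL F PF F1.
exists (vec_mx v); split; first by have [] := L1v.
move=> g; apply/ler_addgt0Pr => e e0.
have : closure (L e) v by move=> B nB; apply: clv => //; exists e.
rewrite -(closure_id _).1; last exact: closed_admissible_bounded.
by move=> [_ ]; exact.
Qed.

(** With [S], the form [act h S] is a minimizer too. By the parallelogram identity their midpoint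
    lowers the bound [m] by a positive multiple of [frob (S - act h S)], which must then be zero. *)
Lemma invariant_form_exists : exists S : 'M[R]_d,
  [/\ S^T = S, forall u : 'rV[R]_d, u != 0 -> 0 < (u *m S *m u^T) ord0 ord0
    & forall g, M g *m S *m (M g)^T = S].
Proof.
have [S [[symS posS] minS]] := minimizer.
exists S; split => // [u u0|h].
  have [g g1] := Mone; have := posS g u; rewrite /act g1 mul1mx trmx1 mulmx1.
  apply: lt_le_trans; rewrite mulr_gt0 ?invr_gt0 //.
  rewrite lt_def frob_ge0 andbT; apply: contra_neq u0 => u0.
  by apply: frob_eq0; rewrite u0.
rewrite -/(act h S); set S' := act h S.
have symS' : S'^T = S' by rewrite /S' /act !trmx_mul trmxK symS mulmxA.
have posS' g (u : 'rV[R]_d) : K1^-1 * frob u <= (u *m act g S' *m u^T) ord0 ord0.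
  by have [k kE] := act_act g h; rewrite kE; exact: posS.
have minS' g : frob (act g S') <= m.
  by have [k kE] := act_act g h; rewrite kE; exact: minS.
(* The factor [K2^-1] makes the gain independent of [g], so that the bound over the whole orbit
   drops. *)
have inb : bounds (m - 4^-1 * (K2^-1 * frob (S - S'))).
  exists (2^-1 *: (S + S')).
    split=> [|g u]; first by rewrite linearZ /= linearD /= symS symS'.
    rewrite act_mid -scalemxAr -scalemxAl mulmxDr mulmxDl mxE mxE.
    have := posS g u; have := posS' g u; lra.
  move=> g; rewrite act_mid frob_parallelogram -actB.
  have := minS g; have := minS' g; have := frob_act_ge g (S - S').
  lra.
have := ge_inf has_inf_bounds.2 inb; rewrite -/m => le1.
have f0 : frob (S - S') <= 0.
  have : K2^-1 * frob (S - S') <= 0 by lra.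
  by rewrite pmulr_rle0 // invr_gt0.
by have /subr0_eq := frob_eq0 f0.
Qed.

End InvariantForm.

(** * Boundedness of Ad on a compact group *)

Section AdInvariantForm.
Variables (R : realType) (d : nat) (G : groupTopologicalType).
Variables (atlas : set (chart R d G)) (HG : lie_group atlas).
Variables (c : chart R d G).
Hypotheses (sc : smooth_chart atlas c) (c1 : chart_dom c 1%g).
Local Notation E := 'rV[R]_d.
Local Notation e := (chart_fun c 1%g).
Local Notation psi := (chart_inv c).

Definition Ad_mx (g : G) : 'M[R]_d := \matrix_(i, j) Ad c g (delta_mx ord0 i) ord0 j.

Lemma mul_Ad_mx g u : u *m Ad_mx g = Ad c g u.
Proof.
apply/rowP => j; rewrite mxE.
pose L : {linear E -> E} := HB.pack (Ad c g) (GRing.isLinear.Build _ _ _ _ _ (@AdP R d G c g)).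
rewrite -[Ad c g u]/(L u) {2}(row_sum_delta u) linear_sum summxE.
by apply: eq_bigr => i _; rewrite linearZ !mxE.
Qed.

(** The order is reversed because matrices act on row vectors from the right. *)
Lemma Ad_mxM g h : Ad_mx (g * h)%g = Ad_mx h *m Ad_mx g.
Proof.
apply/row_matrixP => i; rewrite !rowE; apply: etrans (mul_Ad_mx _ _) _.
apply: etrans (AdM HG sc c1 g h _) _; rewrite mulmxA.
by apply/esym; apply: etrans (mul_Ad_mx _ _) _; rewrite (mul_Ad_mx h).
Qed.

Lemma Ad_mx1 : Ad_mx 1%g = 1%:M.
Proof.
by apply/row_matrixP => i; rewrite !rowE mul_Ad_mx mulmx1; exact: (Ad1 c1).
Qed.

Lemma near_Ad_mx_bounded : exists K : R,
  \forall h \near (1%g : G), frob (Ad_mx h) <= K.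
Proof.
have cf : continuous_at e (fun x => frob (Ad_mx (psi x))).
  suff H i j : continuous_at e (fun x => Ad_mx (psi x) i j ^+ 2).
    by apply: sum_continuous_at => i; apply: sum_continuous_at => j; exact: H.
  have -> : (fun x => Ad_mx (psi x) i j ^+ 2) =
      (fun x => (Ad c (psi x) (delta_mx ord0 i)) ord0 j * (Ad c (psi x) (delta_mx ord0 i)) ord0 j).
    by rewrite funeqE => x; rewrite /Ad_mx mxE expr2.
  have cA : {for e, continuous (fun x => (Ad c (psi x) (delta_mx ord0 i)) ord0 j)}.
    apply: (continuous_comp (f := fun x => Ad c (psi x) (delta_mx ord0 i))
       (g := fun u : E => u ord0 j)); last exact: coord_continuous.
    exact: (smooth_at_cont (Ad_smooth HG sc c1 _)).
  exact: continuousM.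
pose K := frob (Ad_mx (psi e)) + 1; exists K.
have nK : \forall x \near e, frob (Ad_mx (psi x)) <= K.
  have nb : \forall x \near e, ball (frob (Ad_mx (psi e))) 1 (frob (Ad_mx (psi x))).
    exact: cf _ (nbhsx_ballx _ _ ltr01).
  apply: filterS nb => x.
  rewrite -ball_normE /ball_ /= /K => Hx.
  rewrite -lerBlDl; apply: (le_trans (ler_norm _)).
  by rewrite distrC ltW.
have n1 : \forall g \near (1%g : G), frob (Ad_mx (psi (chart_fun c g))) <= K.
  exact: (@chart_fun_continuous _ _ _ c _ c1 _ nK).
have n2 := open_nbhs_nbhs (conj (@chart_dom_open _ _ _ c) c1).
by apply: filterS2 n1 n2 => g + gc; rewrite (chart_funK gc).
Qed.

(** Near [g] write h = g (g^-1 h), where g^-1 h is close to 1 and Ad is bounded by continuity.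
    Submultiplicativity bounds Ad near every [g], and compactness makes the bound global. *)
Lemma Ad_mx_bounded : compact [set: G] -> exists C : R, forall g, frob (Ad_mx g) <= C.
Proof.
move=> cG; have [K nK] := near_Ad_mx_bounded.
have H (g : G) : exists K' : R, \forall h \near g, frob (Ad_mx h) <= K'.
  exists (frob (Ad_mx g) * K).
  have tc : {for g, continuous (fun h : G => (g^-1 * h)%g)}.
    apply: (@continuous_comp _ _ _ (fun h : G => (g^-1, h)%g) (fun gh : G * G => (gh.1 * gh.2)%g)).
      by apply: cvg_pair; [exact: cvg_cst|exact: cvg_id].
    exact: lie_mul_continuous HG _.
  have key (P : set G) : nbhs (1%g : G) P -> nbhs g (fun h => P (g^-1 * h)%g).
    by move=> nP; apply: (tc P); rewrite mulVg.
  apply: filterS (key _ nK) => h hK.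
  have -> : h = (g * (g^-1 * h))%g by rewrite mulgA mulgV mul1g.
  rewrite Ad_mxM mulrC; apply: (le_trans (frob_mul _ _)).
  by apply: ler_wpM2r => //; exact: frob_ge0.
(* The near-covering form of compactness, with the filter at [+oo] as parameter: local bounds
   combine into one valid for all large constants. *)
have := cG; rewrite compact_near_coveringP => /(_ R +oo%R (fun K' h => frob (Ad_mx h) <= K')).
move=> /(_ _); case=> [g _|K1 [_ HK1]].
  have [K' nK'] := H g.
  exists ([set h | frob (Ad_mx h) <= K'], [set x | K' < x]) => /=.
    by split => //; exists K'; split => //; exact: num_real.
  by move=> [h x] /= [hK' Kx]; exact: le_trans hK' (ltW Kx).
exists (K1 + 1) => g; apply: (HK1 (K1 + 1)) => //.
by rewrite ltrDl.
Qed.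

Lemma Ad_invariant_form : compact [set: G] -> exists S : 'M[R]_d,
  [/\ S^T = S, forall u : E, u != 0 -> 0 < (u *m S *m u^T) ord0 ord0
    & forall g (u v : E), (Ad c g u *m S *m (Ad c g v)^T) ord0 ord0 = (u *m S *m v^T) ord0 ord0].
Proof.
move=> /Ad_mx_bounded[C bC].
have [|||S [symS posS invS]] := @invariant_form_exists R d G Ad_mx C _ _ _ bC.
- by move=> g h; exists (h * g)%g; exact: Ad_mxM.
- by exists 1%g; exact: Ad_mx1.
- by move=> g; exists (g^-1)%g; rewrite -Ad_mxM mulVg; exact: Ad_mx1.
exists S; split=> // g u v.
by rewrite -(mul_Ad_mx g u) -(mul_Ad_mx g v) trmx_mul -!mulmxA (mulmxA S) (mulmxA (Ad_mx g)) (mulmxA (Ad_mx g)) invS.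
Qed.

End AdInvariantForm.

(** * Vectors fixed by a finite star-subgroup *)

Section LocalInverse.
Variables (R : realType) (d : nat).
Local Notation E := 'rV[R]_d.

Lemma rV_norm_le (v : E) (k : R) : 0 <= k -> (forall i, `|v ord0 i| <= k) -> `|v| <= k.
Proof.
move=> k0 vk; rewrite /Num.Def.normr /= mx_normrE; apply: bigmax_le => // -[i j] _ /=.
by rewrite ord1.
Qed.

Lemma rV_coord_le (v : E) i : `|v ord0 i| <= `|v|.
Proof.
rewrite [leRHS]/Num.Def.normr /= mx_normrE.
exact: (le_bigmax _ (fun ij : 'I_1 * 'I_d => `|v ij.1 ij.2|) (ord0, i)).
Qed.

Lemma ball_segment (x y z : E) (r t : R) : 0 <= t <= 1 ->
  ball z r x -> ball z r y -> ball z r (y + t *: (x - y)).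
Proof.
rewrite -!ball_normE /ball_ /= => /andP[t0 t1] zx zy.
have -> : z - (y + t *: (x - y)) = (1 - t) *: (z - y) + t *: (z - x).
  by apply/rowP => i; rewrite !mxE; ring.
have t1' : 0 <= 1 - t by lra.
apply: (le_lt_trans (ler_normD _ _)); rewrite !normrZ !ger0_norm //.
have [t00|tn0] := eqVneq t 0.
  by rewrite t00 subr0 mul1r mul0r addr0.
have tp : 0 < t by rewrite lt_def tn0.
have A1 : (1 - t) * `|z - y| <= (1 - t) * r by rewrite ler_wpM2l // ltW.
have A2 : t * `|z - x| < t * r by rewrite ltr_pM2l.
by have := ler_ltD A1 A2; rewrite -mulrDl subrK mul1r.
Qed.

Variables (f : E -> E) (e : E).
Hypotheses (sf : smooth_at f e) (df : forall v, 'd f e v = v).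

(** Near [e] the derivative moves each basis vector by at most 1/(2d); the [d] coordinates of [v],
    each at most [|v|] in absolute value, add up to the factor 1/2. *)
Lemma near_diff_small : \forall x \near e,
  differentiable f x /\ forall v, `|'d f x v - v| <= 2^-1 * `|v|.
Proof.
have H (i : 'I_d) : \forall x \near e,
    `|'d f x (delta_mx ord0 i) - delta_mx ord0 i| <= (2 * d%:R)^-1.
  have cd := smooth_at_cont (smooth_at_d (delta_mx ord0 i) sf).
  have k0 : 0 < (2 * d%:R)^-1 :> R.
    by rewrite invr_gt0 mulr_gt0 // ltr0n (leq_ltn_trans _ (ltn_ord i)).
  have gen (g : E -> E) y0 : {for e, continuous g} -> g e = y0 ->
      \forall x \near e, `|g x - y0| <= (2 * d%:R)^-1.
    move=> cg <-; have nb : \forall x \near e, ball (g e) (2 * d%:R)^-1 (g x).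
      exact: cg _ (nbhsx_ballx _ _ k0).
    by apply: filterS nb => x; rewrite -ball_normE /ball_ /= distrC => /ltW.
  exact: gen cd (df _).
have H' : \forall x \near e, forall i : 'I_d,
    `|'d f x (delta_mx ord0 i) - delta_mx ord0 i| <= (2 * d%:R)^-1.
  exact: (@filter_forall E 'I_d (fun i x => `|'d f x (delta_mx ord0 i) - delta_mx ord0 i| <= (2 * d%:R)^-1) (nbhs e) _ H).
apply: filterS2 (smooth_at_near sf) H' => x sx hx; split; first exact: smooth_at_diff.
move=> v.
have -> : 'd f x v - v = \sum_i v ord0 i *: ('d f x (delta_mx ord0 i) - delta_mx ord0 i).
  rewrite {1 2}(row_sum_delta v) linear_sum -sumrB; apply: eq_bigr => i _.
  by rewrite linearZ scalerBr.
apply: (le_trans (ler_norm_sum _ _ _)).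
have [d0|d0] := eqVneq d 0%N.
  rewrite big1 ?mulr_ge0 ?invr_ge0 // => i _; by have := ltn_ord i; rewrite {2}d0.
apply: (@le_trans _ _ (\sum_(i < d) `|v| * (2 * d%:R)^-1)).
  apply: ler_sum => i _; rewrite normrZ; apply: ler_pM => //; exact: rV_coord_le.
have dn0 : d%:R != 0 :> R by rewrite pnatr_eq0.
by rewrite sumr_const card_ord -[leLHS]mulr_natr le_eqVlt; apply/orP; left; apply/eqP; field.
Qed.

(** [f - id] has a derivative of norm at most 1/2. The mean value theorem is applied to one
    coordinate at a time, which is enough for the sup norm. *)
Lemma near_id_lipschitz : exists2 r, 0 < r & forall x y, ball e r x -> ball e r y ->
  `|(f x - f y) - (x - y)| <= 2^-1 * `|x - y|.
Proof.
have /nbhs_ballP[r /= r0 rP] := near_diff_small.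
exists r => // x y ex ey; apply: rV_norm_le => [|i]; first by rewrite mulr_ge0 ?invr_ge0.
pose p (w : E) : R := w ord0 i.
have pl : linear p by move=> a w z; rewrite /p !mxE.
pose L : {linear E -> R} := HB.pack p (GRing.isLinear.Build _ _ _ _ _ pl).
have cL : continuous L by exact: coord_continuous.
have inb t : 0 <= t <= 1 -> ball e r (y + t *: (x - y)) by move=> t01; exact: ball_segment.
have dL t : 0 <= t <= 1 -> differentiable (L \o f) (y + t *: (x - y)) /\
    forall v, 'd (L \o f) (y + t *: (x - y)) v = L ('d f (y + t *: (x - y)) v).
  by move=> t01; have [dfx _] := rP _ (inb t t01); exact: diff_lincomp.
have [t t01 E1] := MVT_line ltr01 (fun t t01 => (dL t t01).1).
rewrite mul1r scale1r (dL t t01).2 in E1.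
have xy : y + (x - y) = x by rewrite addrC subrK.
rewrite xy in E1.
have -> : ((f x - f y) - (x - y)) ord0 i =
    ('d f (y + t *: (x - y)) (x - y) - (x - y)) ord0 i.
  rewrite mxE [RHS]mxE; congr (_ + _).
  by apply: etrans E1; rewrite !mxE.
apply: (le_trans (rV_coord_le _ _)).
by have [_] := rP _ (inb t t01); exact.
Qed.

(** Solving f x = w is a fixed point problem for [T x = x - f x + w], a contraction of factor 1/2.
    The closed ball of radius s = 2 |w - f e| is stable, as |T x - e| <= s/2 + |w - f e| = s. *)
Lemma local_inverse : exists2 r, 0 < r &
  (forall x y, ball e r x -> ball e r y -> f x = f y -> x = y) /\
  forall w, `|w - f e| < r / 4 -> exists2 x, `|x - e| <= 2 * `|w - f e| & f x = w.
Proof.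
have [r r0 rP] := near_id_lipschitz.
exists r => //; split=> [x y ex ey fxy|w we].
  have := rP x y ex ey; rewrite fxy subrr sub0r normrN => H.
  by apply/subr0_eq/normr0_eq0; have := normr_ge0 (x - y); lra.
pose s := 2 * `|w - f e|.
have [we0|we0] := eqVneq w (f e).
  by exists e => //; rewrite subrr normr0 mulr_ge0.
have s0 : 0 < s by rewrite mulr_gt0 // normr_gt0 subr_eq0.
have sr : s < r by rewrite /s; lra.
pose U := closed_ball_ (fun v : E => `|v|) e s : set E.
have Ub x : U x -> ball e r x.
  by rewrite /U /closed_ball_ /= -ball_normE /ball_ /= => /le_lt_trans; apply.
have Ue : U e by rewrite /U /closed_ball_ /= subrr normr0 ltW.
pose T x := x - f x + w.
have Tlip x y : U x -> U y -> `|T x - T y| <= 2^-1 * `|x - y|.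
  move=> /Ub ex /Ub ey; have := rP x y ex ey.
  suff -> : T x - T y = - ((f x - f y) - (x - y)) by rewrite normrN.
  by apply/rowP => i; rewrite !mxE; ring.
have TU : set_fun U U T.
  move=> x Ux; rewrite /U /closed_ball_ /=.
  have h1 := Tlip x e Ux Ue.
  have -> : e - T x = - (T x - T e) - (w - f e).
    by apply/rowP => i; rewrite !mxE; ring.
  apply: (le_trans (ler_normB _ _)); rewrite normrN.
  have : `|x - e| <= s by rewrite distrC; exact: Ux.
  by move: h1; rewrite /s; lra.
pose F : {fun U >-> U} := HB.pack T (isFun.Build _ _ U U T TU).
have cF : is_contraction F.
  exists (2^-1)%:nng; split => /=; first by lra.
  by move=> [x y] [Ux Uy] /=; exact: Tlip.
have cU : closed U by exact: closed_closed_ball_.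
pose X : completeNormedModType R := HB.pack_for (completeNormedModType R) 'rV[R]_d.
have [x Ux Fx] := @banach_fixed_point R X U F cF cU (ex_intro _ e Ue).
exists x; first by rewrite distrC; exact: Ux.
have xE : x = x - f x + w by exact: Fx.
apply/rowP => i; have := congr1 (fun z : E => z ord0 i) xE; rewrite !mxE => H.
lra.
Qed.

End LocalInverse.

(** * The centralizer near 1 and the averaged chart *)

Section FixedVectors.
Variables (R : realType) (d : nat) (G : groupTopologicalType).
Variables (atlas : set (chart R d G)) (HG : lie_group atlas).
Variables (c : chart R d G).
Hypotheses (sc : smooth_chart atlas c) (c1 : chart_dom c 1%g).
Local Notation E := 'rV[R]_d.
Local Notation e := (chart_fun c 1%g).
Local Notation psi := (chart_inv c).

(** A finite set is discrete, whereas a slice of positive dimension contains a segment through each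
    of its points. *)
Lemma finite_has_dim0 (A : set G) k :
  A 1%g -> finite_set A -> has_dim atlas A k -> k = 0%N.
Proof.
move=> A1 fA [kd /(_ _ A1)[c' [sc' c'1 Ec']]].
case: k kd Ec' => // k kd Ec'; exfalso.
pose x0 := chart_fun c' 1%g.
(* Index [k] is the last free coordinate of a slice of dimension [k.+1], so that moving along [u]
   stays in the slice. *)
pose u : E := delta_mx ord0 (Ordinal kd).
have fin : finite_set (chart_fun c' @` (chart_dom c' `&` A) `\ x0).
  apply: finite_setD; apply: finite_image; exact: finite_setIr.
have ncl : \forall x \near x0, ~ (chart_fun c' @` (chart_dom c' `&` A) `\ x0) x.
  apply: open_nbhs_nbhs; split; last by move=> [_ ]; exact.
  rewrite -[X in open X]/(~` _); apply: closed_openC.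
  by apply: (@accessible_finite_set_closed E).1 => //; apply: hausdorff_accessible; exact: norm_hausdorff.
have x0i : chart_img c' x0 by exists 1%g.
have nim := open_nbhs_nbhs (conj (@chart_img_open _ _ _ c') x0i).
have [/= r r0 rP] := (nbhs_ballP _ _).1 (filterI ncl nim).
pose x := x0 + (r / 2) *: u.
have un0 : u != 0.
  by apply/eqP => /rowP/(_ (Ordinal kd)); rewrite !mxE !eqxx /= => /eqP; rewrite oner_eq0.
have un : `|u| <= 1.
  by apply: rV_norm_le => // i; rewrite mxE eqxx /=; case: eqP => _; rewrite ?normr1 ?normr0.
have bx : ball x0 r x.
  rewrite -ball_normE /ball_ /= /x opprD addrA subrr sub0r normrN normrZ.
  rewrite ger0_norm; last by rewrite divr_ge0 // ltW.
  by apply: (@le_lt_trans _ _ (r / 2 * 1)); [rewrite ler_wpM2l // divr_ge0 // ltW|lra].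
have [nx ix] := rP x bx.
apply: nx; split; last first.
  rewrite /= /x => /eqP; rewrite -subr_eq0 addrC addKr scaler_eq0 (negbTE un0) orbF.
  by rewrite mulf_eq0 invr_eq0 (gt_eqF r0) pnatr_eq0.
suff : (chart_fun c' @` (chart_dom c' `&` A)) x by [].
rewrite Ec'; split => // i ki.
have : (chart_img c' `&` [set x | forall i : 'I_d, (k.+1 <= i)%N -> x ord0 i = 0]) x0.
  by rewrite -Ec'; exists 1%g.
move=> [_ /(_ i ki)] x0i0; rewrite /x !mxE x0i0 add0r eqxx /=.
by case: eqP => [E1|_]; [move: ki; rewrite E1 ltnn|rewrite mulr0].
Qed.

(** A slice of dimension 0 has only the point with all coordinates zero, and a chart is injective on
    its domain. *)
Lemma star_centralizer_isolated (A : set G) : star_subgroup atlas A -> finite_set A ->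
  \forall g \near (1%g : G), centralizer A g -> g = 1%g.
Proof.
move=> [[A1 _ _] _ _ [k [dZ dA]]] fA.
have k0 := finite_has_dim0 A1 fA dA.
have Z1 : centralizer A 1%g by move=> a _; rewrite mul1g mulg1.
have [c' [sc' c'1 Ec']] := dZ.2 _ Z1.
have phi0 g : chart_dom c' g -> centralizer A g -> chart_fun c' g = 0.
  move=> cg Zg.
  have : (chart_fun c' @` (chart_dom c' `&` centralizer A)) (chart_fun c' g) by exists g.
  rewrite Ec' => -[_ H]; apply/rowP => i; rewrite mxE; apply: H.
  by rewrite k0.
apply: filterS (open_nbhs_nbhs (conj (@chart_dom_open _ _ _ c') c'1)) => g cg Zg.
by rewrite -(chart_funK cg) (phi0 g cg Zg) -(phi0 1%g c'1 Z1) chart_funK.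
Qed.

Lemma near_all_seq (T : topologicalType) (I : eqType) (s : seq I) (P : I -> T -> Prop) (x : T) :
  (forall i, i \in s -> \forall y \near x, P i y) ->
  \forall y \near x, forall i, i \in s -> P i y.
Proof.
elim: s => [|i s IH] H; first by apply: nearW => y i.
have Hi := H i (mem_head _ _).
have Hs := IH (fun j js => H j (mem_behead (s := i :: s) js)).
apply: filterS2 Hi Hs => y Piy Psy j; rewrite inE => /orP[/eqP->//|]; exact: Psy.
Qed.

Lemma Ad0 g : Ad c g 0 = 0.
Proof. by have := AdP c g (-1) (0 : E) 0; rewrite scaler0 addr0 scaleN1r addNr. Qed.

Lemma AdZ g k v : Ad c g (k *: v) = k *: Ad c g v.
Proof. by rewrite -[k *: v]addr0 AdP Ad0 addr0. Qed.

Lemma AdD g u v : Ad c g (u + v) = Ad c g u + Ad c g v.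
Proof. by rewrite -[u]scale1r AdP !scale1r. Qed.

Lemma Ad_sum g I (s : seq I) (F : I -> E) :
  Ad c g (\sum_(i <- s) F i) = \sum_(i <- s) Ad c g (F i).
Proof. exact: (big_morph (Ad c g) (AdD g) (Ad0 g)). Qed.

(** The chart recentred at 0 is averaged over the action that combines conjugation on the source
    with Ad on the target. When [s] enumerates a finite group, the average is equivariant. *)
Definition average_chart (s : seq G) (x : E) : E :=
  (size s)%:R^-1 *: \sum_(a <- s) Ad c a^-1%g (conj_chart c a x - e).

Lemma average_chart1 s : average_chart s e = 0.
Proof.
rewrite /average_chart big1 ?scaler0 // => a _.
by rewrite (conj_chart1 c1 a) subrr Ad0.
Qed.

(** The derivative is Ad(a^-1) Ad(a). Each summand of the average thus has the identity as
    derivative at [e], so averaging does not destroy the local diffeomorphism. *)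
Lemma diff_conj_sub (a : G) (v : E) :
  smooth_at (fun x => Ad c a^-1%g (conj_chart c a x - e)) e /\
  'd (fun x => Ad c a^-1%g (conj_chart c a x - e)) e v = v.
Proof.
have s1 := conj_smooth HG sc c1 a.
have cL := @Ad_cont _ _ _ _ HG _ sc c1 a^-1%g.
have s2 : smooth_at (fun x => conj_chart c a x - e) e.
  exact: (smooth_atD s1 (smooth_at_cst (- e) e)).
split; first exact: (smooth_at_lincomp cL s2).
have [_ E1] := diff_lincomp cL (smooth_at_diff s2).
apply: etrans (E1 v) _.
have E2 : 'd (fun x => conj_chart c a x - e) e v = Ad c a v.
  have [dt dtE] := diff_translate (conj_chart c a e) (- e).
  apply: etrans (diff_compE v (smooth_at_diff s1) dt) _.
  exact: dtE.
apply: etrans (congr1 (Ad c a^-1%g) E2) _.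
apply: etrans (esym (AdM HG sc c1 a^-1%g a v)) _.
by rewrite mulVg; exact: (Ad1 c1).
Qed.

Lemma average_chart_smooth s : smooth_at (average_chart s) e /\
  forall v, s != [::] -> 'd (average_chart s) e v = v.
Proof.
have H : smooth_at (fun x => \sum_(a <- s) Ad c a^-1%g (conj_chart c a x - e)) e /\
   forall v, 'd (fun x => \sum_(a <- s) Ad c a^-1%g (conj_chart c a x - e)) e v = (size s)%:R *: v.
  elim: s => [|a s [IH1 IH2]].
    rewrite (_ : (fun x => _) = fun=> 0); last by rewrite funeqE => x; rewrite big_nil.
    by split=> [|v]; [exact: smooth_at_cst|rewrite diff_constE scale0r].
  pose F x := Ad c a^-1%g (conj_chart c a x - e).
  pose H x := \sum_(a <- s) Ad c a^-1%g (conj_chart c a x - e).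
  rewrite (_ : (fun x => _) = F \+ H); last by rewrite funeqE => x; rewrite big_cons.
  have sF : smooth_at F e := (diff_conj_sub a 0).1.
  split=> [|v]; first exact: smooth_atD.
  apply: etrans (congr1 (fun h => h v) (diffD (smooth_at_diff sF) (smooth_at_diff IH1))) _.
  apply: etrans (f_equal2 +%R (diff_conj_sub a v).2 (IH2 v)) _.
  by rewrite /= -[X in X + _]scale1r -scalerDl mulrS.
pose L := ( *:%R ((size s)%:R^-1 : R)) : {linear E -> E}.
have cL : continuous L by exact: scaler_continuous.
split; first exact: (smooth_at_lincomp cL H.1).
move=> v s0; have [_ E1] := diff_lincomp cL (smooth_at_diff H.1).
apply: etrans (E1 v) _; rewrite H.2 /L /= scalerA mulVf ?scale1r //.
by rewrite pnatr_eq0 size_eq0.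
Qed.

(** Right multiplication by [b] permutes [s], and Ad(a^-1) = Ad(b) Ad((a b)^-1). *)
Lemma average_chart_conj (s : seq G) b : uniq s ->
  (forall a a', a \in s -> a' \in s -> (a * a')%g \in s) -> b \in s ->
  \forall x \near e, average_chart s (conj_chart c b x) = Ad c b (average_chart s x).
Proof.
move=> us sM bs.
apply: filterS (near_conj_dom HG sc c1 b) => x bx.
rewrite /average_chart (AdZ b) (Ad_sum b); congr (_ *: _).
have pe : perm_eq [seq (a * b)%g | a <- s] s.
  have inj : injective (fun a : G => (a * b)%g) by exact: mulIg.
  have um : uniq [seq (a * b)%g | a <- s] by rewrite map_inj_uniq.
  have sub : {subset [seq (a * b)%g | a <- s] <= s}.
    by move=> _ /mapP[a as_ ->]; exact: sM.
  apply: uniq_perm => //; apply: (uniq_min_size um sub _).2.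
  by rewrite size_map.
rewrite -[RHS](perm_big _ pe) big_map; apply: eq_bigr => a _.
apply: etrans _ (AdM HG sc c1 b (a * b)^-1%g _).
by rewrite invgM mulgA mulgV mul1g /conj_chart (chart_funK bx) invgM !mulgA.
Qed.

Theorem fixed_vectors_trivial (A : set G) : star_subgroup atlas A -> finite_set A ->
  forall Y, (forall a, A a -> Ad c a Y = Y) -> Y = 0.
Proof.
move=> sA fA Y fixY.
have [[A1 AM AV] _ _ _] := sA.
have [s0 As0] := (finite_seqP A).1 fA.
pose s := undup s0.
have As a : (a \in s) <-> A a by rewrite As0 /= mem_undup.
have sN : s != [::] by apply/eqP => s0'; have := (As 1%g).2 A1; rewrite s0'.
have us : uniq s := undup_uniq s0.
have sM a a' : a \in s -> a' \in s -> (a * a')%g \in s.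
  by move=> /As Aa /As Aa'; apply/As; exact: AM.
have [sf df] := average_chart_smooth s.
have [r r0 [inj surj]] := local_inverse sf (fun v => df v sN).
rewrite average_chart1 in surj.
pose P1 x := forall a, a \in s ->
  average_chart s (conj_chart c a x) = Ad c a (average_chart s x).
have n1 : nbhs e P1.
  apply: (@near_all_seq E G s (fun a x => average_chart s (conj_chart c a x) =
    Ad c a (average_chart s x)) e) => a as_.
  exact: average_chart_conj.
pose P2 x := forall a, a \in s -> ball e r (conj_chart c a x).
have n2 : nbhs e P2.
  apply: (@near_all_seq E G s (fun a x => ball e r (conj_chart c a x)) e) => a as_.
  have cc := smooth_at_cont (conj_smooth HG sc c1 a).
  by apply: (cc (ball e r)); rewrite (conj_chart1 c1 a); exact: nbhsx_ballx.
(* Allows the conjugate of [psi x] to be recovered from its coordinates. *)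
pose P3 x := forall a, a \in s -> chart_dom c (a * psi x * a^-1)%g.
have n3 : nbhs e P3.
  apply: (@near_all_seq E G s (fun a x => chart_dom c (a * psi x * a^-1)%g) e) => a as_.
  exact: (near_conj_dom HG sc c1).
pose P4 x := centralizer A (psi x) -> psi x = 1%g.
have n4 : nbhs e P4.
  have pc : {for e, continuous psi} by have [] := Gsmooth_psi HG sc c1.
  apply: (pc (fun g => centralizer A g -> g = 1%g)).
  by rewrite (chart_inv1 c1); exact: star_centralizer_isolated.
have n5 : nbhs e (chart_img c) := near_chart_img c1.
have nn : nbhs e ((P1 `&` P2) `&` ((P3 `&` P4) `&` chart_img c)).
  by do ?apply: filterI.
case/nbhs_ballP: nn => [del /= del0 delP].
have [//|Y0] := eqVneq Y 0.
(* The norm of [t *: Y] is min(r/8, del/4): it is below r/4, so a preimage exists, and that preimage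
   lies within min(r/4, del/2) of [e], hence in both balls. *)
pose t := Num.min (r / 8) (del / 4) / `|Y|.
have Yp : 0 < `|Y| by rewrite normr_gt0.
have mp : 0 < Num.min (r / 8) (del / 4) by rewrite lt_min !divr_gt0.
have tp : 0 < t by rewrite divr_gt0.
have tY : `|t *: Y| = Num.min (r / 8) (del / 4).
  by rewrite normrZ gtr0_norm // divfK // gt_eqF.
have m1 : Num.min (r / 8) (del / 4) <= r / 8 by rewrite ge_min lexx.
have m2 : Num.min (r / 8) (del / 4) <= del / 4 by rewrite ge_min lexx orbT.
have [|x xe fx] := surj (t *: Y); first by rewrite subr0 tY; lra.
rewrite subr0 tY in xe.
have ex : ball e del x by rewrite -ball_normE /ball_ /= distrC; lra.
have [[h1 h2] [[h3 h4] h5]] := delP x ex.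
have bx : ball e r x by rewrite -ball_normE /ball_ /= distrC; lra.
(* The averaged chart takes the value [t *: Y] at [x] and at its conjugate, since Ad(a) fixes [Y];
   local injectivity identifies the two points. *)
have fixx a : a \in s -> conj_chart c a x = x.
  move=> as_; apply: inj => //; first exact: h2.
  rewrite (h1 a as_) fx.
  by rewrite AdZ (fixY a ((As a).1 as_)).
have Zx : centralizer A (psi x).
  move=> a /As as_; have := congr1 psi (fixx a as_).
  rewrite /conj_chart (chart_funK (h3 a as_)) => {1}<-.
  by rewrite mulgVK.
have xe1 : x = e by rewrite -(chart_invK h5) (h4 Zx).
have : t *: Y = 0 by rewrite -fx xe1 average_chart1.
by move/eqP; rewrite scaler_eq0 (gt_eqF tp) (negbTE Y0).
Qed.

End FixedVectors.

(** * Complexification and weights *)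

Local Notation ReV := Defs.ReV.
Local Notation ImV := Defs.ImV.
Local Notation Re := complex.Re.
Local Notation Im := complex.Im.

Section ComplexVectors.
Variables (R : realType) (d : nat).
Local Notation E := 'rV[R]_d.
Local Notation EC := 'rV[R[i]]_d.
Implicit Types (Z U V W : EC) (z : R[i]).

Lemma eq_ReImV Z W : ReV Z = ReV W -> ImV Z = ImV W -> Z = W.
Proof.
move=> /rowP HR /rowP HI; apply/rowP => i; move: (HR i) (HI i); rewrite !mxE.
by case: (Z ord0 i) => a b; case: (W ord0 i) => a' b' /= -> ->.
Qed.

Lemma ReVP z U V : ReV (z *: U + V) = Re z *: ReV U - Im z *: ImV U + ReV V.
Proof.
apply/rowP => i; rewrite !mxE; case: z => x y.
by case: (U ord0 i) => a b; case: (V ord0 i) => a' b'.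
Qed.

Lemma ImVP z U V : ImV (z *: U + V) = Re z *: ImV U + Im z *: ReV U + ImV V.
Proof.
apply/rowP => i; rewrite !mxE; case: z => x y.
by case: (U ord0 i) => a b; case: (V ord0 i) => a' b'.
Qed.

Lemma ReV_cplx (X : E) : ReV (cplx X) = X.
Proof. by apply/rowP => i; rewrite !mxE. Qed.

Lemma ImV_cplx (X : E) : ImV (cplx X) = 0.
Proof. by apply/rowP => i; rewrite !mxE. Qed.

Lemma ReV_decomp (X Y : E) : ReV (cplx X + 'i%C *: cplx Y) = X.
Proof.
by rewrite addrC ReVP !ReV_cplx ImV_cplx /= scale0r scaler0 subr0 add0r.
Qed.

Lemma ImV_decomp (X Y : E) : ImV (cplx X + 'i%C *: cplx Y) = Y.
Proof.
by rewrite addrC ImVP !ReV_cplx !ImV_cplx /= scaler0 add0r scale1r addr0.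
Qed.

Lemma cplx_decomp Z : Z = cplx (ReV Z) + 'i%C *: cplx (ImV Z).
Proof. by apply: eq_ReImV; rewrite ?ReV_decomp ?ImV_decomp. Qed.

Lemma ReV0 : ReV (0 : EC) = 0. Proof. by apply/rowP => i; rewrite !mxE. Qed.
Lemma ImV0 : ImV (0 : EC) = 0. Proof. by apply/rowP => i; rewrite !mxE. Qed.

Lemma ReVD U V : ReV (U + V) = ReV U + ReV V.
Proof. by rewrite -[U]scale1r ReVP /= scale0r subr0 !scale1r. Qed.

Lemma ImVD U V : ImV (U + V) = ImV U + ImV V.
Proof. by rewrite -[U]scale1r ImVP /= scale0r addr0 !scale1r. Qed.

Definition conjV Z : EC := cplx (ReV Z) - 'i%C *: cplx (ImV Z).

Lemma ReV_conj Z : ReV (conjV Z) = ReV Z.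
Proof. by rewrite /conjV -scaleNr addrC ReVP !ReV_cplx ImV_cplx /= oppr0 scale0r scaler0 subr0 add0r. Qed.

Lemma ImV_conj Z : ImV (conjV Z) = - ImV Z.
Proof. by rewrite /conjV -scaleNr addrC ImVP !ReV_cplx !ImV_cplx /= scaler0 add0r scaleN1r addr0. Qed.

Lemma conjVK : involutive conjV.
Proof. by move=> Z; apply: eq_ReImV; rewrite !(ReV_conj, ImV_conj) ?opprK. Qed.

Lemma conjVP z U V : conjV (z *: U + V) = (z^*)%C *: conjV U + conjV V.
Proof.
apply: eq_ReImV.
  rewrite ReV_conj !ReVP !ReV_conj ImV_conj; case: z => x y /=.
  by apply/rowP => i; rewrite !mxE; ring.
rewrite ImV_conj !ImVP !ImV_conj ReV_conj; case: z => x y /=.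
by apply/rowP => i; rewrite !mxE; ring.
Qed.

Lemma conjV0 : conjV 0 = 0.
Proof. by apply: eq_ReImV; rewrite ?ReV_conj ?ImV_conj ?ReV0 ?ImV0 ?oppr0. Qed.

Lemma range_cplxP Z : range (@cplx R d) Z <-> ImV Z = 0.
Proof.
split=> [[X _ <-]|Z0]; first exact: ImV_cplx.
by exists (ReV Z) => //; apply: eq_ReImV; rewrite ?ReV_cplx ?ImV_cplx.
Qed.

Lemma ReV_linC (f : E -> E) Z : ReV (linC f Z) = f (ReV Z).
Proof. exact: ReV_decomp. Qed.

Lemma ImV_linC (f : E -> E) Z : ImV (linC f Z) = f (ImV Z).
Proof. exact: ImV_decomp. Qed.

Lemma ReV_bilinC (b : E -> E -> E) Z W :
  ReV (bilinC b Z W) = b (ReV Z) (ReV W) - b (ImV Z) (ImV W).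
Proof. exact: ReV_decomp. Qed.

Lemma ImV_bilinC (b : E -> E -> E) Z W :
  ImV (bilinC b Z W) = b (ReV Z) (ImV W) + b (ImV Z) (ReV W).
Proof. exact: ImV_decomp. Qed.

End ComplexVectors.


(* [re], [im] and [B] stand for ReV, ImV and bilinC br, which are kept abstract
   because rewriting would otherwise unfold them. *)
Lemma leibniz_complexified (R : realType) (d : nat) (C : Type)
    (re im : C -> 'rV[R]_d) (B : C -> C -> C) (br : 'rV[R]_d -> 'rV[R]_d -> 'rV[R]_d) :
  (forall X Y Z, br (X + Y) Z = br X Z + br Y Z) ->
  (forall X Y Z, br Z (X + Y) = br Z X + br Z Y) ->
  (forall X Z, br (- X) Z = - br X Z) -> (forall X Z, br Z (- X) = - br Z X) ->
  (forall X Y Z, br X (br Y Z) = br (br X Y) Z + br Y (br X Z)) ->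
  (forall U V, re (B U V) = br (re U) (re V) - br (im U) (im V)) ->
  (forall U V, im (B U V) = br (re U) (im V) + br (im U) (re V)) ->
  forall U V W,
    re (B U (B V W)) = re (B (B U V) W) + re (B V (B U W)) /\
    im (B U (B V W)) = im (B (B U V) W) + im (B V (B U W)).
Proof.
move=> brDl brDr brNl brNr L reB imB U V W; rewrite !(reB, imB).
move: (re U) (im U) (re V) (im V) (re W) (im W) => x x' y y' z z'.
rewrite !(brDl, brDr) !(brNl, brNr); split.
  rewrite (L x y z) (L x y' z') (L x' y z') (L x' y' z).
  by apply/rowP => i; rewrite !mxE; ring.
rewrite (L x y z') (L x y' z) (L x' y z) (L x' y' z').
by apply/rowP => i; rewrite !mxE; ring.
Qed.

(** * The complexified Lie algebra with its invariant Hermitian form *)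

Section CompactForm.
Variables (R : realType) (d : nat).
Local Notation E := 'rV[R]_d.
Local Notation EC := 'rV[R[i]]_d.
Variables (br : E -> E -> E) (b : E -> E -> R).
Hypothesis brPl : forall a X Y Z, br (a *: X + Y) Z = a *: br X Z + br Y Z.
Hypothesis brPr : forall a X Y Z, br Z (a *: X + Y) = a *: br Z X + br Z Y.
Hypothesis br_anti : forall X Y, br X Y = - br Y X.
Hypothesis br_leibniz : forall X Y Z, br X (br Y Z) = br (br X Y) Z + br Y (br X Z).
Hypothesis bPl : forall a u v w, b (a *: u + v) w = a * b u w + b v w.
Hypothesis b_sym : forall u v, b u v = b v u.
Hypothesis b_gt0 : forall u, u != 0 -> 0 < b u u.
Hypothesis b_inv : forall X u v, b (br X u) v = - b u (br X v).

Local Notation brC := (bilinC br).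

Lemma form0l w : b 0 w = 0.
Proof. by have := bPl (-1) 0 0 w; rewrite scaler0 addr0 => H; lra. Qed.

Lemma formDl u v w : b (u + v) w = b u w + b v w.
Proof. by rewrite -{1}[u]scale1r bPl mul1r. Qed.

Lemma formZl a u w : b (a *: u) w = a * b u w.
Proof. by rewrite -[a *: u]addr0 bPl form0l addr0. Qed.

Lemma formNl u w : b (- u) w = - b u w.
Proof. by rewrite -scaleN1r formZl mulN1r. Qed.

Lemma formDr u v w : b w (u + v) = b w u + b w v.
Proof. by rewrite b_sym formDl !(b_sym w). Qed.

Lemma formZr a u w : b w (a *: u) = a * b w u.
Proof. by rewrite b_sym formZl b_sym. Qed.

Lemma formNr u w : b w (- u) = - b w u.
Proof. by rewrite b_sym formNl b_sym. Qed.

Lemma form_ge0 u : 0 <= b u u.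
Proof. by have [->|/b_gt0/ltW//] := eqVneq u 0; rewrite form0l. Qed.

Lemma br0l Z : br 0 Z = 0.
Proof.
have := brPl (-1) 0 0 Z; rewrite scaler0 addr0 scaleN1r addNr => ->; exact: erefl.
Qed.

Lemma brDl X Y Z : br (X + Y) Z = br X Z + br Y Z.
Proof. by rewrite -{1}[X]scale1r brPl scale1r. Qed.

Lemma brZl a X Z : br (a *: X) Z = a *: br X Z.
Proof. by rewrite -[a *: X]addr0 brPl br0l addr0. Qed.

Lemma brNl X Z : br (- X) Z = - br X Z.
Proof. by rewrite -scaleN1r brZl scaleN1r. Qed.

Lemma br0r Z : br Z 0 = 0.
Proof. by rewrite br_anti br0l oppr0. Qed.

Lemma brDr X Y Z : br Z (X + Y) = br Z X + br Z Y.
Proof. by rewrite -{1}[X]scale1r brPr scale1r. Qed.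

Lemma brZr a X Z : br Z (a *: X) = a *: br Z X.
Proof. by rewrite -[a *: X]addr0 brPr br0r addr0. Qed.

Lemma brNr X Z : br Z (- X) = - br Z X.
Proof. by rewrite -scaleN1r brZr scaleN1r. Qed.

Lemma brC_Pl z U V W : brC (z *: U + V) W = z *: brC U W + brC V W.
Proof.
apply: eq_ReImV; rewrite ?ReV_bilinC ?ImV_bilinC ?ReVP ?ImVP ?ReV_bilinC ?ImV_bilinC;
  case: z => x y /=; rewrite ?(brDl, brNl, brZl); apply/rowP => i; rewrite !mxE; ring.
Qed.

Lemma brC_anti U V : brC U V = - brC V U.
Proof.
rewrite -scaleN1r -[_ *: _]addr0; apply: eq_ReImV;
  rewrite ?ReVP ?ImVP ?ReV0 ?ImV0 ?ReV_bilinC ?ImV_bilinC /=.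
  rewrite (br_anti (ReV U)) (br_anti (ImV U)); apply/rowP => i; rewrite !mxE; ring.
rewrite (br_anti (ReV U)) (br_anti (ImV U)); apply/rowP => i; rewrite !mxE; ring.
Qed.

Lemma brC_0l W : brC 0 W = 0.
Proof. by apply: eq_ReImV; rewrite ?ReV_bilinC ?ImV_bilinC ReV0 ImV0 !br0l ?subr0 ?addr0. Qed.

Lemma brC_0r W : brC W 0 = 0.
Proof. by rewrite brC_anti brC_0l oppr0. Qed.

Lemma brC_Pr z U V W : brC W (z *: U + V) = z *: brC W U + brC W V.
Proof. by rewrite brC_anti brC_Pl opprD -scalerN -!brC_anti. Qed.

Lemma brC_leibniz U V W : brC U (brC V W) = brC (brC U V) W + brC V (brC U W).
Proof.
have [H1 H2] := leibniz_complexified brDl brDr brNl brNr br_leibniz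
  (ReV_bilinC br) (ImV_bilinC br) U V W.
apply: eq_ReImV.
  exact: etrans H1 (esym (ReVD (brC (brC U V) W) (brC V (brC U W)))).
exact: etrans H2 (esym (ImVD (brC (brC U V) W) (brC V (brC U W)))).
Qed.

(* The real part of the invariant Hermitian form. *)
Definition hform (U V : EC) : R := b (ReV U) (ReV V) + b (ImV U) (ImV V).

Lemma hform_sym U V : hform U V = hform V U.
Proof. by rewrite /hform b_sym [b (ImV U) _]b_sym. Qed.

Lemma hform_Pl z U V W : hform (z *: U + V) W = hform U ((z^*)%C *: W) + hform V W.
Proof.
rewrite /hform ReVP ImVP -[_ *: W]addr0 ReVP ImVP ReV0 ImV0 !addr0.
case: z => x y /=.
rewrite !(formDl, formDr, formNl, formNr, formZl, formZr); ring.
Qed.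

Lemma hformDr U V W : hform W (U + V) = hform W U + hform W V.
Proof.
rewrite -[U]scale1r hform_sym hform_Pl hform_sym [hform V W]hform_sym.
by rewrite conjc1 !scale1r.
Qed.

Lemma hformZr (r : R) U W : hform W (r%:C%C *: U) = r * hform W U.
Proof.
rewrite /hform -[_ *: U]addr0 ReVP ImVP ReV0 ImV0 !addr0 /= !scale0r subr0 addr0.
by rewrite !formZr mulrDr.
Qed.

Lemma hformNr U W : hform W (- U) = - hform W U.
Proof.
have := hformZr (-1) U W; rewrite mulN1r => <-; congr hform.
by rewrite (_ : (-1)%:C%C = -1) ?scaleN1r //; apply/eqP; rewrite eq_complex /= oppr0 !eqxx.
Qed.

Lemma hform0r W : hform W 0 = 0.
Proof. by rewrite hform_sym /hform ReV0 ImV0 !form0l addr0. Qed.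

Lemma hform_eq0 U : hform U U = 0 -> U = 0.
Proof.
move=> H; have h1 := form_ge0 (ReV U); have h2 := form_ge0 (ImV U).
have z1 : b (ReV U) (ReV U) = 0 by move: H; rewrite /hform; lra.
have z2 : b (ImV U) (ImV U) = 0 by move: H; rewrite /hform; lra.
apply: eq_ReImV; rewrite ?ReV0 ?ImV0; apply/eqP; apply: contraT => /b_gt0.
  by rewrite z1 ltxx.
by rewrite z2 ltxx.
Qed.

(** For [hform], the adjoint of ad Z is - ad (conjV Z); on real elements this is [b_inv]. *)
Lemma hform_inv Z U V : hform (brC Z U) V = - hform U (brC (conjV Z) V).
Proof.
rewrite /hform !(ReV_bilinC, ImV_bilinC, ReV_conj, ImV_conj) !(brNl).
rewrite !(formDl, formDr, formNl, formNr) !b_inv; ring.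
Qed.

(* An element commuting with its conjugate acts by a normal operator, so that
   ker ad(Z)^j = ker ad(Z). *)
Lemma normal_kernel Z j V : brC Z (conjV Z) = 0 -> iter j.+1 (brC Z) V = 0 ->
  brC Z V = 0.
Proof.
move=> ZZ.
have comm W : brC Z (brC (conjV Z) W) = brC (conjV Z) (brC Z W).
  by rewrite brC_leibniz ZZ brC_0l add0r.
(* Put N = ad Z and N' = ad (conj Z), so that -N' is the adjoint of N. As N and N' commute, N^2 W =
   0 gives |N' N W|^2 = -<N W, N' N N W> = 0, and then |N W|^2 = -<W, N' N W> = 0. *)
have sq W : brC Z (brC Z W) = 0 -> brC Z W = 0.
  move=> N2.
  have N'N : brC (conjV Z) (brC Z W) = 0.
    apply: hform_eq0; rewrite hform_inv conjVK comm N2 brC_0r.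
    by rewrite hform0r oppr0.
  by apply: hform_eq0; rewrite hform_inv N'N hform0r oppr0.
by elim: j => [//|j IH] /= H; apply: IH; exact: sq.
Qed.

(** * Weight spaces and their brackets *)

Section Weights.
Variables (T : Type) (A : set T) (ad : T -> E -> E).
Hypothesis adP : forall a k u v, ad a (k *: u + v) = k *: ad a u + ad a v.
Hypothesis ad_br : forall a u v, ad a (br u v) = br (ad a u) (ad a v).
Hypothesis fixed0 : forall Y, (forall a, A a -> ad a Y = Y) -> Y = 0.

(** This is [root_space] for an abstract family [ad] of real automorphisms, which keeps the argument
    on weights free of charts. *)
Definition weight_space (lam : T -> R[i]) : set EC :=
  [set Y | forall a, A a -> linC (ad a) Y = lam a *: Y].

Lemma linC_bracket a U V : linC (ad a) (brC U V) = brC (linC (ad a) U) (linC (ad a) V).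
Proof.
have adD u v : ad a (u + v) = ad a u + ad a v by rewrite -[u]scale1r adP !scale1r.
have adB u v : ad a (u - v) = ad a u - ad a v.
  by rewrite -scaleN1r addrC adP scaleN1r addrC.
apply: eq_ReImV.
  rewrite (ReV_linC _ (brC U V)) (ReV_bilinC _ U) adB !ad_br; apply/esym.
  by apply: etrans (ReV_bilinC _ _ _) _; rewrite !ReV_linC !ImV_linC.
rewrite (ImV_linC _ (brC U V)) (ImV_bilinC _ U) adD !ad_br; apply/esym.
by apply: etrans (ImV_bilinC _ _ _) _; rewrite !ReV_linC !ImV_linC.
Qed.

Lemma linC_P a z U V : linC (ad a) (z *: U + V) = z *: linC (ad a) U + linC (ad a) V.
Proof.
have ad0 : ad a 0 = 0 by have := adP a (-1) 0 0; rewrite scaler0 addr0 scaleN1r addNr.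
have adD u v : ad a (u + v) = ad a u + ad a v by rewrite -[u]scale1r adP !scale1r.
have adZ k u : ad a (k *: u) = k *: ad a u by rewrite -[k *: u]addr0 adP ad0 addr0.
have adN u : ad a (- u) = - ad a u by rewrite -scaleN1r adZ scaleN1r.
apply: eq_ReImV; rewrite !(ReV_linC, ImV_linC, ReVP, ImVP);
by rewrite !(adD, adN, adZ).
Qed.

Lemma weight_subspace lam z U V : weight_space lam U -> weight_space lam V ->
  weight_space lam (z *: U + V).
Proof.
move=> HU HV a Aa; rewrite linC_P HU // HV //.
by rewrite scalerDr !scalerA mulrC.
Qed.

Lemma weight_bracket lam mu U V : weight_space lam U -> weight_space mu V ->
  weight_space (fun a => lam a * mu a) (brC U V).
Proof.
move=> HU HV a Aa; rewrite linC_bracket HU // HV //.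
have brC_Zl z X Y : brC (z *: X) Y = z *: brC X Y.
  by rewrite -[z *: X]addr0 brC_Pl brC_0l addr0.
have brC_Zr z X Y : brC Y (z *: X) = z *: brC Y X.
  by rewrite -[z *: X]addr0 brC_Pr brC_0r addr0.
by rewrite brC_Zl brC_Zr scalerA.
Qed.

(** The complexification of a real map commutes with [conjV], which is antilinear. *)
Lemma weight_conj lam U : weight_space lam U ->
  weight_space (fun a => (lam a)^*%C) (conjV U).
Proof.
move=> HU a Aa; have H := HU a Aa.
have -> : linC (ad a) (conjV U) = conjV (linC (ad a) U).
  have ad0 : ad a 0 = 0 by have := adP a (-1) 0 0; rewrite scaler0 addr0 scaleN1r addNr.
  apply: eq_ReImV.
    by rewrite (ReV_linC _ (conjV U)) !ReV_conj ReV_linC.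
  rewrite (ImV_linC _ (conjV U)) !ImV_conj ImV_linC.
  by rewrite -scaleN1r -[_ *: _]addr0 adP ad0 addr0 scaleN1r.
by rewrite H -[_ *: U]addr0 conjVP conjV0 addr0.
Qed.

(** The real and imaginary parts of [U] are both fixed vectors. *)
Lemma weight_trivial lam U : (forall a, A a -> lam a = 1) -> weight_space lam U -> U = 0.
Proof.
move=> lam1 HU; apply: eq_ReImV; rewrite ?ReV0 ?ImV0; apply: fixed0 => a Aa;
  have := HU a Aa; rewrite lam1 // scale1r => H.
  by rewrite -[in RHS]H ReV_linC.
by rewrite -[in RHS]H ImV_linC.
Qed.

Lemma weight_iter lam mu Z V j : weight_space lam Z -> weight_space mu V ->
  weight_space (fun a => lam a ^+ j * mu a) (iter j (brC Z) V).
Proof.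
move=> HZ HV; elim: j => [|j IH] a Aa /=; first by rewrite expr0 mul1r HV.
by have := weight_bracket HZ IH Aa; rewrite mulrA -exprS.
Qed.

Lemma unit_mul_conj (z : R[i]) : `|z| = 1 -> z * z^*%C = 1.
Proof. by move=> z1; rewrite -sqr_normc z1 expr1n. Qed.

(* Z = [X, Y] has weight lam + mu, and lam is a multiple j (lam + mu), so that
   ad(Z)^j maps conj X into the zero weight space. As ad Z is normal, Z commutes
   with conj X, whence |Z|^2 = 0 by invariance. *)
Lemma coprime_weights_commute lam mu P Q X Y : coprime P Q ->
  (forall a, A a -> `|lam a| = 1) -> (forall a, A a -> `|mu a| = 1) ->
  (forall a, A a -> lam a ^+ P = 1) -> (forall a, A a -> mu a ^+ Q = 1) ->
  weight_space lam X -> weight_space mu Y -> brC X Y = 0.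
Proof.
move=> cPQ nlam nmu lamP muQ HX HY; set Z := brC X Y.
have HZ : weight_space (fun a => lam a * mu a) Z := weight_bracket HX HY.
have ZZ : brC Z (conjV Z) = 0.
  apply: weight_trivial (weight_bracket HZ (weight_conj HZ)) => a Aa.
  by apply: unit_mul_conj; rewrite normrM nlam // nmu // mulr1.
(* As j = 1 mod P and j = 0 mod Q, the j-th power of lam mu is lam. *)
pose j := chinese P Q 1 0.
have it0 : iter j (brC Z) (conjV X) = 0.
  apply: weight_trivial (weight_iter j HZ (weight_conj HX)) => a Aa.
  rewrite exprMn.
  have -> : lam a ^+ j = lam a.
    rewrite -(expr_mod j (lamP a Aa)) /j chinese_modl //.
    by rewrite expr_mod ?lamP.
  have -> : mu a ^+ j = 1.
    rewrite -(expr_mod j (muQ a Aa)) /j chinese_modr //.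
    by rewrite expr_mod ?muQ.
  by rewrite mulr1 unit_mul_conj ?nlam.
have ZX : brC Z (conjV X) = 0.
  (* [normal_kernel] concerns positive exponents; for [j = 0] the vanishing of the iterate already
     says that conj X = 0. *)
  case: j it0 => [/= ->|j it0]; first exact: brC_0r.
  exact: normal_kernel ZZ it0.
by apply: hform_eq0; rewrite {1}/Z hform_inv brC_anti ZX oppr0 hform0r oppr0.
Qed.

End Weights.

(** * Orthogonal complements of ideals and real points *)

Section Reductive.
Variable L : set EC.
Hypotheses (Lsub : is_subspace L) (Lbr : bracket_closed brC L).
Hypothesis Lconj : forall U, L U -> L (conjV U).

(** Gram-Schmidt by induction on [s]. Membership of [v] in the real span of [s] is expressed as
    membership in every real subspace containing [s]. *)
Lemma orthogonal_projection (s : seq EC) (u : EC) : exists v,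
  (forall K : set EC, is_real_subspace K -> (forall w, w \in s -> K w) -> K v) /\
  forall w, w \in s -> hform (u - v) w = 0.
Proof.
elim: s u => [|w s IH] u.
  by exists 0; split => // K [].
have [pw [pwS pwO]] := IH w.
have [pu [puS puO]] := IH u.
pose w' := w - pw.
(* If the part of [w] orthogonal to [s] vanishes, [w] already lies in the span of [s] and the
   projection is unchanged. *)
have [w0|w0] := eqVneq (hform w' w') 0.
  have w'0 : w = pw by apply: subr0_eq; exact: hform_eq0.
  exists pu; split=> [K KS Ks|x].
    by apply: puS => // x xs; apply: Ks; rewrite inE xs orbT.
  rewrite inE => /orP[/eqP->|]; last exact: puO.
  pose K := [set x | hform (u - pu) x = 0] : set EC.
  rewrite w'0; apply: (pwS K) => [|y ys]; last exact: puO.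
  split=> [|r y z Ky Kz]; first exact: hform0r.
  by rewrite /K /= hformDr hformZr Ky Kz mulr0 addr0.
(* The Gram-Schmidt coefficient along [w'], the part of [w] orthogonal to [s]. *)
pose t := hform (u - pu) w' / hform w' w'.
exists (t%:C%C *: w' + pu); split=> [K KS Ks|].
  have [K0 Klin] := KS.
  have Kpw : K pw by apply: pwS => // x xs; apply: Ks; rewrite inE xs orbT.
  have Kpu : K pu by apply: puS => // x xs; apply: Ks; rewrite inE xs orbT.
  have Kw : K w by apply: Ks; rewrite mem_head.
  apply: (Klin t _ _ _ Kpu); rewrite /w' addrC.
  have := Klin (-1) pw w Kpw Kw.
  by rewrite (_ : (-1)%:C%C = -1) ?scaleN1r //; apply/eqP; rewrite eq_complex /= oppr0 !eqxx.
pose K := [set x | hform (u - (t%:C%C *: w' + pu)) x = 0] : set EC.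
have hx x : hform (u - (t%:C%C *: w' + pu)) x = hform (u - pu) x - t * hform w' x.
  have -> : u - (t%:C%C *: w' + pu) = (u - pu) - t%:C%C *: w'.
    by rewrite opprD [- _ - _]addrC addrA.
  by rewrite hform_sym hformDr hformNr hformZr !(hform_sym x).
have Ks x : x \in s -> K x.
  by move=> xs; rewrite /K /= hx puO // pwO // mulr0 subr0.
have KS : is_real_subspace K.
  split=> [|r x y Kx Ky]; first exact: hform0r.
  by rewrite /K /= hformDr hformZr Kx Ky mulr0 addr0.
have Kw' : K w' by rewrite /K /= hx /t divfK // subrr.
move=> x; rewrite inE => /orP[/eqP->|]; last exact: Ks.
have Kpw : K pw by apply: pwS.
have -> : w = 1%:C%C *: w' + pw by rewrite (_ : 1%:C%C = 1) // scale1r /w' subrK.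
exact: KS.2.
Qed.

(** Take the rows of a matrix of maximal rank among those with rows in [J]: a vector of [J] outside
    their span would raise the rank. *)
Lemma subspace_spanning (J : set EC) : is_subspace J ->
  exists s : seq EC, (forall w, w \in s -> J w) /\
    forall K : set EC, is_subspace K -> (forall w, w \in s -> K w) -> J `<=` K.
Proof.
move=> [J0 JP].
pose P k := `[< exists M : 'M[R[i]]_d, (forall i, J (row i M)) /\ \rank M = k >].
have exP : exists k, P k.
  by exists (\rank (0 : 'M[R[i]]_d)); apply/asboolP; exists 0; split=> // i; rewrite row0.
have bP k : P k -> (k <= d)%N by move=> /asboolP[M [_ <-]]; exact: rank_leq_row.
have [k /asboolP[M [JM rM]] maxk] := ex_maxnP exP bP.
have subJ (N : 'M[R[i]]_d) : (forall i, J (row i N)) -> forall v : EC, (v <= N)%MS -> J v.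
  move=> JN v /submxP[D ->]; rewrite mulmx_sum_row.
  elim/big_ind: _ => // [x y Jx Jy|i _]; first by rewrite -[x]scale1r; exact: JP.
  by rewrite -[_ *: _]addr0; exact: JP.
exists [seq row i M | i <- enum 'I_d]; split=> [w /mapP[i _ ->]//|K [K0 KP] Ks v Jv].
have vM : (v <= M)%MS.
  apply: contraT => nvM.
  have lt : (\rank M < \rank (M + v)%MS)%N.
    by apply: rank_ltmx; rewrite /ltmx addsmxSl /= addsmx_sub submx_refl.
  suff PMv : P (\rank (M + v)%MS) by have := maxk _ PMv; rewrite -rM leqNgt lt.
  apply/asboolP; exists (M + v)%MS; split=> // i.
  have /sub_addsmxP[[D1 D2] /= ->] : (row i (M + v)%MS <= M + v)%MS by exact: row_sub.
  have J1 : J (D1 *m M) by apply: (subJ M JM); exact: submxMl.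
  have J2 : J (D2 *m v) by rewrite [D2]mx11_scalar mul_scalar_mx -[_ *: v]addr0; exact: JP.
  by rewrite -[D1 *m M]scale1r; exact: JP.
move/submxP: vM => [D ->]; rewrite mulmx_sum_row.
elim/big_ind: _ => // [x y Jx Jy|i _]; first by rewrite -[x]scale1r; exact: KP.
rewrite -[_ *: _]addr0; apply: KP => //; apply: Ks; apply/mapP; exists i => //.
by rewrite mem_enum.
Qed.

Lemma conj_stable_reductive : is_reductive brC L.
Proof.
move=> J [[J0 JP] JL Jbr].
pose J' := [set v | L v /\ forall w, J w -> hform v w = 0] : set EC.
have [L0 LP] := Lsub.
exists J'; split.
- split.
  + split=> [|z u v [Lu Hu] [Lv Hv]]; first by split=> // w _; rewrite hform_sym hform0r.
    split=> [|w Jw]; first exact: LP.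
    rewrite hform_Pl Hv // addr0; apply: Hu.
    by rewrite -[_ *: w]addr0; exact: JP.
  + by move=> v [].
  + move=> u v Lu [Lv Hv]; split=> [|w Jw]; first exact: Lbr.
    (* <[u, v], w> = -<v, [conj u, w]>, where [conj u, w] lies in [J] because L contains conj u. *)
    by rewrite hform_inv Hv ?oppr0 //; apply: Jbr => //; exact: Lconj.
- rewrite eqEsubset; split=> [v [Jv [_ Hv]]|_ ->] /=.
    by apply: hform_eq0; exact: Hv.
  by split=> //; split=> // w _; rewrite hform_sym hform0r.
- move=> u Lu; have [s [sJ sspan]] := subspace_spanning (conj J0 JP).
  (* [hform] is only the real part of the Hermitian form and the projection is real, so
     orthogonality to the multiples by i has to be imposed as well. *)
  pose s' := s ++ [seq 'i%C *: w | w <- s].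
  have [v [vS vO]] := orthogonal_projection s' u.
  have Jv : J v.
    apply: vS => [|w]; first by split=> // r x y; exact: JP.
    rewrite mem_cat => /orP[/sJ//|/mapP[x /sJ Jx ->]].
    by rewrite -[_ *: x]addr0; exact: JP.
  exists v, (u - v); split=> //; last by rewrite addrC subrK.
  split; first by rewrite -scaleN1r addrC; apply: LP => //; exact: JL.
  pose K := [set w | hform (u - v) w = 0 /\ hform (u - v) ('i%C *: w) = 0] : set EC.
  have KK : is_subspace K.
    split=> [|z x y [x1 x2] [y1 y2]]; first by rewrite /K /= scaler0 hform0r.
    have zE : z = (Re z)%:C%C + 'i%C * (Im z)%:C%C by exact: complexE.
    rewrite /K /= zE; split.
      rewrite scalerDl !hformDr [_ * _]mulrC -scalerA !hformZr x1 x2 y1.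
      by rewrite !mulr0 !addr0.
    rewrite scalerDr scalerA mulrDr mulrA -expr2 sqr_i mulN1r.
    rewrite scalerDl !hformDr scaleNr hformNr [_ * _]mulrC -scalerA !hformZr x1 x2 y2.
    by rewrite !mulr0 oppr0 !addr0.
  move=> w Jw; have [] := sspan K KK _ w Jw => // x xs.
  split; apply: vO; rewrite mem_cat ?xs //.
  by apply/orP; right; apply/mapP; exists x.
Qed.

Lemma conj_stable_compact_real_form :
  is_compact_real_form brC L (L `&` range (@cplx R d)).
Proof.
have [L0 LP] := Lsub.
have realP (U V : EC) (r : R) : ImV U = 0 -> ImV V = 0 -> ImV (r%:C%C *: U + V) = 0.
  by move=> U0 V0; rewrite ImVP U0 V0 /= scaler0 scale0r !addr0.
split; first split.
- split; first by split=> //; apply/range_cplxP; exact: ImV0.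
  move=> r u v [Lu /range_cplxP u0] [Lv /range_cplxP v0].
  by split; [exact: LP|apply/range_cplxP; exact: realP].
- move=> u v [Lu /range_cplxP u0] [Lv /range_cplxP v0]; split; first exact: Lbr.
  by apply/range_cplxP; rewrite ImV_bilinC u0 v0 br0l br0r addr0.
- by move=> u [].
- move=> u Lu.
  have LRe : L (cplx (ReV u)).
    have -> : cplx (ReV u) = (2^-1)%:C%C *: u + ((2^-1)%:C%C *: conjV u + 0).
      apply: eq_ReImV; rewrite ?ReV_cplx ?ImV_cplx ?ReVP ?ImVP ?ReV_conj ?ImV_conj ?ReV0 ?ImV0 /=;
        by apply/rowP => i; rewrite !mxE; field.
    by apply: (LP) => //; apply: LP => //; exact: Lconj.
  have LIm : L (cplx (ImV u)).
    (* Im u = -i u + i Re u. *)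
    have -> : cplx (ImV u) = Complex 0 (- 1) *: u + ('i%C *: cplx (ReV u) + 0).
      apply: eq_ReImV; rewrite ?ReVP ?ImVP ?ReV_cplx ?ImV_cplx ?ReV0 ?ImV0 /=;
        by apply/rowP => i; rewrite !mxE; ring.
    by apply: (LP) => //; exact: LP.
  exists (cplx (ReV u), cplx (ImV u)); split=> /=.
    by split; [split=> //; exists (ReV u)|split=> //; exists (ImV u)|exact: cplx_decomp].
  move=> [v w] /= [[_ [x _ <-]] [_ [y _ <-]] ->].
  by rewrite ReV_decomp ImV_decomp.
exists (fun u v => b (ReV u) (ReV v)); split.
- move=> r u v w [_ /range_cplxP u0] _ _.
  by rewrite ReVP u0 scaler0 subr0 /= bPl.
- by move=> u v _ _; rewrite b_sym.
- move=> u [_ /range_cplxP u0] un0; apply: b_gt0.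
  by apply: contra_neq un0 => r0; apply: eq_ReImV; rewrite ?ReV0 ?ImV0.
- move=> u v w [_ /range_cplxP u0] [_ /range_cplxP v0] [_ /range_cplxP w0].
  by rewrite !ReV_bilinC u0 v0 w0 !br0l !subr0 b_inv.
Qed.

End Reductive.

End CompactForm.

(** * The sum of the root spaces of prime power order *)

Section SubspaceSum.
Variables (R : realType) (d : nat) (I : Type) (P : set I).
Local Notation EC := 'rV[R[i]]_d.
Variable V : I -> set EC.

Lemma subspace_sum_ind (K : set EC) : K 0 -> (forall x y, K x -> K y -> K (x + y)) ->
  (forall i x, P i -> V i x -> K x) -> subspace_sum P V `<=` K.
Proof.
move=> K0 KD KV _ [m [i [v [H ->]]]]; elim/big_ind: _ => // j _.
by have [Pj Vj] := H j; exact: KV Vj.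
Qed.

Lemma subspace_sum_incl i x : P i -> V i x -> subspace_sum P V x.
Proof.
move=> Pi Vx; exists 1%N, (fun=> i), (fun=> x); split=> //.
by rewrite big_ord1.
Qed.

Lemma subspace_sumD x y :
  subspace_sum P V x -> subspace_sum P V y -> subspace_sum P V (x + y).
Proof.
move=> [m [i [v [Hv ->]]]] [m' [i' [v' [Hv' ->]]]].
exists (m + m')%N,
  (fun j => match fintype.split j with inl k => i k | inr k => i' k end),
  (fun j => match fintype.split j with inl k => v k | inr k => v' k end); split.
  by move=> j; case: fintype.split => k; [exact: Hv|exact: Hv'].
rewrite big_split_ord /=; congr (_ + _); apply: eq_bigr => k _.
  case: splitP => l /= kl; first by congr v; exact: val_inj.
  by have := ltn_ord k; rewrite kl ltnNge leq_addr.
case: splitP => l /= kl; first by have := ltn_ord l; rewrite -kl ltnNge leq_addr.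
by congr v'; apply: val_inj; move/addnI: kl.
Qed.

Lemma subspace_sum_subspace : (forall i, P i -> is_subspace (V i)) ->
  is_subspace (subspace_sum P V).
Proof.
move=> VS.
have S0 : subspace_sum P V 0.
  (* The index type [I] may be empty, so the empty family is built from the contradiction
     [ltn_ord j]. *)
  exists 0%N, (fun j : 'I_0 => match notF (ltn_ord j) with end), (fun=> 0); split; first by case.
  by rewrite big_ord0.
split=> // z u v Su Sv; apply: subspace_sumD => //.
apply: (subspace_sum_ind (K := [set x | subspace_sum P V (z *: x)])) Su.
- by rewrite /= scaler0.
- by move=> x y; rewrite /= scalerDr; exact: subspace_sumD.
- move=> i x Pi Vx; apply: (subspace_sum_incl Pi).
  have [V0 VP] := VS i Pi.
  by rewrite -[_ *: x]addr0; exact: VP.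
Qed.

End SubspaceSum.

(** * Stability of g' under conjugation, Ad and the bracket *)

Section GPrime.
Variables (R : realType) (d : nat) (G : groupTopologicalType).
Variables (atlas : set (chart R d G)) (c : chart R d G) (A : set G) (n : nat).
Hypotheses (HG : lie_group atlas) (sc : smooth_chart atlas c) (c1 : chart_dom c 1%g).
Hypotheses (sA : star_subgroup atlas A) (fA : finite_set A).
Local Notation E := 'rV[R]_d.
Local Notation EC := 'rV[R[i]]_d.
Local Notation g' := (g_prime c A n).
Local Notation brC := (bilinC (lie_bracket c)).

Variable b : E -> E -> R.
Hypothesis bPl : forall a u v w, b (a *: u + v) w = a * b u w + b v w.
Hypothesis b_sym : forall u v, b u v = b v u.
Hypothesis b_gt0 : forall u, u != 0 -> 0 < b u u.
Hypothesis b_inv : forall X u v, b (lie_bracket c X u) v = - b u (lie_bracket c X v).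

Let brPl := @bracketPl R d G c.
Let brPr := @bracketPr R d G atlas HG c sc c1.
Let brA := @bracket_anti R d G atlas HG c sc c1.
Let brL := @bracket_leibniz R d G atlas HG c sc c1.
Let fixed0 := @fixed_vectors_trivial R d G atlas HG c sc c1 A sA fA.

Lemma root_space_subspace alpha : is_subspace (root_space c A alpha).
Proof.
split=> [a Aa|z u v].
  rewrite scaler0; apply: eq_ReImV; rewrite ?ReV_linC ?ImV_linC ?ReV0 ?ImV0; exact: Ad0.
exact: (weight_subspace (fun a => @AdP R d G c a)).
Qed.

Lemma g_prime_subspace : is_subspace g'.
Proof.
apply: subspace_sum_subspace => p _; apply: subspace_sum_subspace => alpha _.
exact: root_space_subspace.
Qed.

Lemma g_prime_incl p alpha Y : prime p -> (p %| n)%N ->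
  root_p c A n p alpha -> root_space c A alpha Y -> g' Y.
Proof.
move=> pp pn ra Ya; apply: (subspace_sum_incl (i := p)) => //.
exact: (subspace_sum_incl (i := alpha)).
Qed.

Lemma g_prime_ind (K : set EC) : K 0 -> (forall x y, K x -> K y -> K (x + y)) ->
  (forall p alpha Y, prime p -> (p %| n)%N -> root_p c A n p alpha ->
    root_space c A alpha Y -> K Y) -> g' `<=` K.
Proof.
move=> K0 KD H; apply: subspace_sum_ind => // p x [pp pn].
by apply: subspace_sum_ind => // alpha y ra; exact: H ra.
Qed.

(** Conjugation carries the root space of alpha to that of the conjugate character, which is the
    inverse root and has the same order. *)
Lemma g_prime_conj U : g' U -> g' (conjV U).
Proof.
have [L0 LP] := g_prime_subspace.
apply: (g_prime_ind (K := [set U | g' (conjV U)])).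
- by rewrite /= conjV0.
- move=> x y /= gx gy.
  by have := conjVP 1 x y; rewrite scale1r conjc1 => ->; exact: LP.
- move=> p alpha Y pp pn [[[aM an] ant [Z Za Z0]] ap] Ya.
  have adP := fun a => @AdP R d G c a.
  apply: (g_prime_incl (alpha := fun a => (alpha a)^*%C) pp pn).
  + split; last by move=> a Aa; rewrite -rmorphXn /= ap // rmorph1.
    split.
    * split=> [a a' Aa Aa'|a Aa]; first by rewrite aM // rmorphM.
      by rewrite normcJ an.
    * move=> a1; apply: ant => a Aa; apply: (can_inj (@conjcK R)).
      by rewrite a1 // conjc1.
    * exists (conjV Z); first exact: (weight_conj adP).
      by apply: contra_neq Z0 => Z0; rewrite -[Z]conjVK Z0 conjV0.
  + exact: (weight_conj adP).
Qed.

Lemma g_prime_Ad a : A a -> AdC c a @` g' `<=` g'.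
Proof.
move=> Aa _ [U gU <-]; have [L0 LP] := g_prime_subspace.
have adP := fun a => @AdP R d G c a.
apply: (g_prime_ind (K := [set U | g' (AdC c a U)])) gU.
- have [+ _] := root_space_subspace (fun=> 1); move=> /(_ a Aa) /= ->.
  by rewrite scaler0.
- move=> x y /= gx gy.
  have := linC_P adP a 1 x y; rewrite !scale1r /AdC => ->.
  by rewrite -[linC _ x]scale1r; exact: LP.
- move=> p alpha Y pp pn ra Ya /=; rewrite (Ya a Aa).
  apply: (g_prime_incl pp pn ra).
  have [r0 rP] := root_space_subspace alpha.
  by rewrite -[_ *: Y]addr0; exact: rP.
Qed.

Lemma g_prime_bracket : bracket_closed brC g'.
Proof.
have [L0 LP] := g_prime_subspace.
have adP := fun a => @AdP R d G c a.
have adbr := @Ad_bracket R d G atlas HG c sc c1.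
have LD x y : g' x -> g' y -> g' (x + y) by move=> gx gy; rewrite -[x]scale1r; exact: LP.
move=> u v gu gv; move: u gu v gv.
apply: (g_prime_ind (K := [set u | forall v, g' v -> g' (brC u v)])).
- by move=> v _; rewrite (brC_0l brPl).
- move=> x y Kx Ky v gv; rewrite -[x]scale1r (brC_Pl brPl) scale1r.
  by apply: LD; [exact: Kx|exact: Ky].
move=> p alpha X pp pn ra Xa.
apply: (g_prime_ind (K := [set v | g' (brC X v)])).
- by rewrite /= (brC_0r brPl brA).
- move=> x y gx gy /=.
  have E1 := brC_Pr brPl brA 1 x y X; rewrite !scale1r in E1.
  by rewrite E1; exact: (LD _ _ gx gy).
move=> q beta Y qp qn rb Yb /=.
have [[[aM an] ant _] ap] := ra; have [[[bM bn] bnt _] bp] := rb.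
(* For distinct primes the two prime powers are coprime and the bracket vanishes. *)
have [pq|pq] := eqVneq p q; last first.
  rewrite (coprime_weights_commute brPl brPr brA brL bPl b_sym b_gt0 b_inv adP adbr fixed0
    (P := (p ^ logn p n)%N) (Q := (q ^ logn q n)%N) _ an bn ap bp Xa Yb) //.
  by rewrite coprimeXl // coprimeXr // prime_coprime // dvdn_prime2.
subst q.
have Wab := weight_bracket brPl brA adP adbr Xa Yb.
(* A nonzero bracket is itself the vector showing that the product character is a root for [p]. *)
have [->//|Z0] := eqVneq (brC X Y) 0.
apply: (g_prime_incl pp pn _ Wab); split.
  split.
  - split=> [a a' Aa Aa'|a Aa]; first by rewrite aM // bM // mulrACA.
    by rewrite normrM an // bn // mulr1.
  - move=> ab1; move/eqP: Z0; apply; exact: (weight_trivial fixed0 ab1 Wab).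
  - by exists (brC X Y).
by move=> a Aa; rewrite exprMn ap // bp // mulr1.
Qed.

End GPrime.

Theorem theorem4p3 (R : realType) (d : nat) (G : groupTopologicalType)
    (atlas : set (chart R d G)) (c : chart R d G) (A : set G) (n : nat) :
  lie_group atlas -> compact [set: G] ->
  smooth_chart atlas c -> chart_dom c 1%g ->
  star_subgroup atlas A -> finite_set A ->
  (Ad c @` A #= `I_n)%card ->
  let br := bilinC (lie_bracket c) in
  let g' := g_prime c A n in
  let g0 := range (@cplx R d) in
  [/\ is_reductive_subalgebra br g',
      forall a, A a -> AdC c a @` g' `<=` g'
    & is_compact_real_form br g' (g' `&` g0)].
Proof.
move=> HG cG sc c1 sA fA _ br g' g0.
have [S [symS posS invS]] := Ad_invariant_form HG sc c1 cG.
pose b (u v : 'rV[R]_d) : R := (u *m S *m v^T) ord0 ord0.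
have bPl a u v w : b (a *: u + v) w = a * b u w + b v w.
  by rewrite /b !mulmxDl -!scalemxAl !mxE.
have b_sym u v : b u v = b v u.
  have H : (u *m S *m v^T)^T = v *m S *m u^T by rewrite !trmx_mul trmxK symS mulmxA.
  by rewrite /b -H [RHS]mxE.
have bPr a u v w : b w (a *: u + v) = a * b w u + b w v.
  by rewrite b_sym bPl !(b_sym w).
have b_inv X u v : b (lie_bracket c X u) v = - b u (lie_bracket c X v).
  exact: (form_invariant HG sc c1 X u v bPl bPr invS).
have sub := g_prime_subspace c A n.
have brc := @g_prime_bracket R d G atlas c A n HG sc c1 sA fA b bPl b_sym posS b_inv.
have cj := @g_prime_conj R d G c A n.
split.
- split; first by split.
  exact: (conj_stable_reductive (@bracketPl R d G c) bPl b_sym posS b_inv sub brc cj).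
- exact: g_prime_Ad.
- exact: (conj_stable_compact_real_form (@bracketPl R d G c) (bracket_anti HG sc c1) bPl b_sym posS b_inv sub brc cj).
Qed.
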